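(* Let $\Omega\subset\mathbb{R}^n$ be open, $1\le k\le n$, $V$ a distribution of $k$-planes of class $C^1$ on $\Omega$, and $T=\tau\mu$ a normal $k$-current on $\Omega$ with $\partial T=\tau'\mu'$, tangent to $V$. Then the following are equivalent: (i) $\mathrm{span}(\tau'(x))\subset V(x)$ for $\mu'$-a.e. $x$; (ii) the support of $\mu$ does not intersect $N(V)$.
   Context: A distribution of $k$-planes of class $C^1$ is a $C^1$ map $x\mapsto V(x)$ into the Grassmannian of $k$-planes. $V$ is involutive at $x$ if $[w,w'](x)\in V(x)$ for all $C^1$ vectorfields $w,w'$ tangent to $V$ (i.e. $w(y),w'(y)\in V(y)$ for all $y$), where $[w,w']=\mathrm{d}w(w')-\mathrm{d}w'(w)$; $N(V)$ is the open set of non-involutivity points. For an $h$-vector $v$, $\mathrm{span}(v)$ is the smallest subspace $W$ of $\mathbb{R}^n$ with $v\in\Lambda_h(W)$. Normal current: $T$ and $\partial T$ have finite mass; $T=\tau\mu$, $\partial T=\tau'\mu'$ with $\mu,\mu'$ finite positive measures and $\tau,\tau'$ integrable densities nonzero a.e.; $T$ tangent to $V$ means $\mathrm{span}(\tau(x))=V(x)$ for $\mu$-a.e. $x$. *)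

(* Defs.v *)
From HB Require Import structures.
From mathcomp Require Import all_boot all_order all_algebra.
From mathcomp Require Import all_classical all_reals all_analysis.
Set Implicit Arguments. Unset Strict Implicit. Unset Printing Implicit Defensive.
Import Order.TTheory GRing.Theory Num.Theory.
Import numFieldNormedType.Exports.
Local Open Scope classical_set_scope.
Local Open Scope ring_scope.

Definition Rn_borel (R : realType) (n : nat) :=
  g_sigma_algebraType (@open 'rV[R]_n).

Definition evec (R : realType) (n : nat) (j : 'I_n) : 'rV[R]_n := delta_mx 0 j.

(* multi-indices of size h : subsets I of {0..n-1} with #|I| = h;
   h-vectors of R^n have coordinates indexed by them (basis e_I) *)
Definition mindex (n h : nat) := {I : {set 'I_n} | #|I| == h}.
Definition hvec (R : realType) (n h : nat) := mindex n h -> R.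

Definition mi_nth (n h : nat) (I : mindex n h) (b : 'I_h) : 'I_n :=
  enum_val (A := val I) (cast_ord (esym (eqP (valP I))) b).

Definition wedge (R : realType) (n h : nat) (w : 'I_h -> 'rV[R]_n) : hvec R n h :=
  fun I => \det (\matrix_(a < h, b < h) w a 0 (mi_nth I b)).

Definition in_Lambda (R : realType) (n h : nat) (W : 'M[R]_n) (v : hvec R n h) :=
  exists (m : nat) (c : 'I_m -> R) (w : 'I_m -> 'I_h -> 'rV[R]_n),
    (forall j a, (w j a <= W)%MS) /\
    v = (fun I => \sum_(j < m) c j * wedge (w j) I).

(* span(v): the smallest subspace W with v \in Lambda_h(W)
   (= intersection of all such subspaces), as a set of vectors *)
Definition spanv (R : realType) (n h : nat) (v : hvec R n h) : set 'rV[R]_n :=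
  [set u | forall W : 'M[R]_n, in_Lambda W v -> (u <= W)%MS].

Definition rowspace_set (R : realType) (n : nat) (P : 'M[R]_n) : set 'rV[R]_n :=
  [set u | (u <= P)%MS].

Definition C1_on (R : realType) (n : nat) (O : set 'rV[R]_n) (f : 'rV[R]_n -> R) :=
  forall j : 'I_n,
    (forall x, O x -> derivable f x (evec R j)) /\
    {within O, continuous (fun x => 'D_(evec R j) f x)}.

Definition C1_vf (R : realType) (n : nat) (O : set 'rV[R]_n)
  (w : 'rV[R]_n -> 'rV[R]_n) := forall i : 'I_n, C1_on O (fun x => w x 0 i).

(* A distribution of k-planes of class C^1 on O, represented by the
   (C^1) field of orthogonal projections onto the planes: V x is symmetric,
   idempotent, of rank k; the plane V(x) is the row space of V x. *)
Definition C1_distribution (R : realType) (n k : nat) (O : set 'rV[R]_n)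
  (V : 'rV[R]_n -> 'M[R]_n) :=
  (forall x, O x -> [/\ (V x)^T = V x, V x *m V x = V x & \rank (V x) = k]) /\
  (forall i j : 'I_n, C1_on O (fun x => V x i j)).

Definition bracket (R : realType) (n : nat) (w w' : 'rV[R]_n -> 'rV[R]_n)
  (x : 'rV[R]_n) : 'rV[R]_n :=
  'D_(w' x) w x - 'D_(w x) w' x.

Definition involutive_at (R : realType) (n : nat) (O : set 'rV[R]_n)
  (V : 'rV[R]_n -> 'M[R]_n) (x : 'rV[R]_n) :=
  forall w w' : 'rV[R]_n -> 'rV[R]_n,
    C1_vf O w -> C1_vf O w' ->
    (forall y, O y -> (w y <= V y)%MS) -> (forall y, O y -> (w' y <= V y)%MS) ->
    (bracket w w' x <= V x)%MS.

Definition NV (R : realType) (n : nat) (O : set 'rV[R]_n)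
  (V : 'rV[R]_n -> 'M[R]_n) : set 'rV[R]_n :=
  [set x | O x /\ ~ involutive_at O V x].

Definition iter_partial (R : realType) (n : nat) (l : seq 'I_n)
  (f : 'rV[R]_n -> R) : 'rV[R]_n -> R :=
  foldr (fun j g => fun x => 'D_(evec R j) g x) f l.

Definition smooth (R : realType) (n : nat) (f : 'rV[R]_n -> R) :=
  forall (l : seq 'I_n), continuous (iter_partial l f) /\
    forall (j : 'I_n) x, derivable (iter_partial l f) x (evec R j).

(* differential forms on R^n: omega x I is the coefficient of dx_I
   (only the coefficients with #|I| = h matter for an h-form) *)
Definition form (R : realType) (n : nat) := 'rV[R]_n -> {set 'I_n} -> R.

Definition test_form (R : realType) (n : nat) (O : set 'rV[R]_n) (om : form R n) :=
  (forall I, smooth (fun x => om x I)) /\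
  exists K : set 'rV[R]_n, [/\ compact K, K `<=` O &
    forall x, ~ K x -> forall I, om x I = 0].

Definition dform (R : realType) (n : nat) (om : form R n) : form R n :=
  fun x J => \sum_(j in J)
    (-1) ^+ #|[set i in J | (i < j)%N]| * 'D_(evec R j) (fun y => om y (J :\ j)) x.

Definition pairing (R : realType) (n h : nat) (om : form R n)
  (tau : 'rV[R]_n -> hvec R n h) (x : 'rV[R]_n) : R :=
  \sum_(I : mindex n h) om x (val I) * tau x I.

Definition msupport (R : realType) (n : nat)
  (mu : {measure set (Rn_borel R n) -> \bar R}) : set 'rV[R]_n :=
  [set x | forall r : R, 0 < r -> (0 < mu (ball x r))%E].

Definition normal_current (R : realType) (n k : nat) (O : set 'rV[R]_n)
  (mu : {measure set (Rn_borel R n) -> \bar R}) (tau : 'rV[R]_n -> hvec R n k)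
  (mu' : {measure set (Rn_borel R n) -> \bar R}) (tau' : 'rV[R]_n -> hvec R n k.-1) :=
  [/\ (mu setT < +oo)%E /\ (mu' setT < +oo)%E,
      mu (~` O) = 0%E /\ mu' (~` O) = 0%E,
      (forall I, mu.-integrable setT (fun x => (tau x I)%:E)) /\
      (forall I, mu'.-integrable setT (fun x => (tau' x I)%:E)),
      {ae mu, forall x, exists I, tau x I != 0} /\
      {ae mu', forall x, exists I, tau' x I != 0} &
      forall om : form R n, test_form O om ->
        (\int[mu']_x (pairing om tau' x)%:E = \int[mu]_x (pairing (dform om) tau x)%:E)%E].

(* Main.v *)
(* Idea: the rows of [1 - V] are C^1 one-forms [a] spanning the annihilator of
   the plane field.  Since [T] is tangent to [V], [T] contracted with [a]
   vanishes, and testing with [a /\ w] gives [dT(a /\ w) = T(da /\ w)].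
   Condition (i) says that the left-hand side vanishes for all [a] and [w]; as
   the density of [T] spans [V], the right-hand side vanishes for all [w] iff
   [da] vanishes on [V], which by the Cartan formula is involutivity.  The
   algebra is done with creation and annihilation operators on functions of
   index sets; C^1 forms are reached from smooth ones by Bernstein polynomials,
   one coordinate at a time. *)
Require Import Defs.
From HB Require Import structures.
From mathcomp Require Import all_boot all_order all_algebra.
From mathcomp Require Import all_classical all_reals all_analysis.
From mathcomp Require Import ring lra.
Set Implicit Arguments. Unset Strict Implicit. Unset Printing Implicit Defensive.
Import Order.TTheory GRing.Theory Num.Theory.
Import numFieldNormedType.Exports.
Local Open Scope ring_scope.

(** * Creation and annihilation operators *)

(** The forms [a] have coefficients that are only C^1 and only defined on the open set, while the
    current is tested with smooth compactly supported forms; carrying the boundary identity over to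
    [a /\ w] is the analytic bulk of the proof. A Bernstein polynomial in one coordinate has
    coefficients free of that coordinate, so induction on the number of coordinates reaches
    constants, and the polynomial factors are absorbed by the smooth cutoff. The first derivatives
    must converge too, and boundedly, because the limit is taken by dominated convergence against
    the densities. That [da] vanishes on [V] once its contraction with the density vanishes would be
    immediate in an adapted basis, where the density is a multiple of the volume of the plane. No
    basis is chosen here: the density is killed by creation along every vector of the plane, because
    the trace of the projection is its rank, and the commutation relations do the rest. The
    pointwise conclusion is only almost everywhere; it reaches every point of the support because
    [da] on [V] is continuous. *)

Section Fock.
Variables (R : comNzRingType) (n : nat).
Implicit Types (i j : 'I_n) (K : {set 'I_n}) (a b : 'rV[R]_n).

(** The whole exterior algebra, all degrees together, by coefficients on the basis vectors [e_K].
    Operators that change the degree thus become endomorphisms, with no dependent type to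
    transport. *)
Definition fock := {ffun {set 'I_n} -> R^o}.
Implicit Types (u v : fock).

(** The sign of moving [e_j] past the smaller elements of [K], as in [dform]. *)
Definition osign j K : R := (-1) ^+ #|[set i in K | (i < j)%N]|.

(** Contraction with [dx_j]; [cre j] is exterior multiplication by [e_j] on the left. *)
Definition ann j u : fock :=
  [ffun K : {set 'I_n} => if j \in K then 0 else osign j K * u (j |: K)].
Definition cre j u : fock :=
  [ffun K : {set 'I_n} => if j \in K then osign j K * u (K :\ j) else 0].

Lemma osignU1 j i K : i \notin K ->
  osign j (i |: K) = (-1) ^+ (i < j)%N * osign j K.
Proof.
move=> iK; rewrite /osign -exprD; congr (_ ^+ _).
have [ij|ij] /= := boolP (i < j)%N.
  have -> : [set i0 in i |: K | (i0 < j)%N] = i |: [set i0 in K | (i0 < j)%N].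
    apply/finset.setP => x; rewrite !inE; case: eqVneq => [->|] //=.
  by rewrite finset.cardsU1 !inE (negbTE iK).
rewrite add0n; apply: eq_card => x; rewrite !inE.
by case: eqVneq => [->|] //=; rewrite (negbTE ij) andbF.
Qed.

Lemma osign_id j K : osign j (j |: K) = osign j K.
Proof.
have [jK|jK] := boolP (j \in K); first by rewrite (finset.setUidPr _) ?finset.sub1set.
by rewrite osignU1 // ltnn mul1r.
Qed.

Lemma osign_sqr j K : osign j K * osign j K = 1.
Proof. by rewrite /osign -expr2 sqrr_sign. Qed.

Lemma annD j u v : ann j (u + v) = ann j u + ann j v.
Proof. by apply/ffunP => K; rewrite !ffunE; case: ifP; rewrite ?addr0 ?ffunE ?mulrDr. Qed.

Lemma annZ j (c : R) u : ann j (c *: u) = c *: ann j u.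
Proof. by apply/ffunP => K; rewrite !ffunE; case: ifP; rewrite ?ffunE ?scaler0 // scalerAr. Qed.

Lemma creD j u v : cre j (u + v) = cre j u + cre j v.
Proof. by apply/ffunP => K; rewrite !ffunE; case: ifP; rewrite ?addr0 ?ffunE ?mulrDr. Qed.

Lemma creZ j (c : R) u : cre j (c *: u) = c *: cre j u.
Proof. by apply/ffunP => K; rewrite !ffunE; case: ifP; rewrite ?ffunE ?scaler0 // scalerAr. Qed.

HB.instance Definition _ j := GRing.isLinear.Build R fock fock *:%R (ann j)
  (fun c u v => etrans (annD j (c *: u) v) (congr1 (+%R^~ (ann j v)) (annZ j c u))).
HB.instance Definition _ j := GRing.isLinear.Build R fock fock *:%R (cre j)
  (fun c u v => etrans (creD j (c *: u) v) (congr1 (+%R^~ (cre j v)) (creZ j c u))).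

Lemma ann_ann i j u : ann i (ann j u) = - ann j (ann i u).
Proof.
apply/ffunP => K; rewrite !ffunE !inE [j |: (i |: K)]finset.setUCA.
have [->|ij] := eqVneq i j; first by rewrite !(if_same, mulr0) oppr0.
have [iK|iK] := boolP (i \in K); first by rewrite orbT !(if_same, mulr0) oppr0.
have [jK|jK] := boolP (j \in K); first by rewrite orbT !(if_same, mulr0) oppr0.
(* Since [i] and [j] differ, exactly one of the two insertions changes a sign. *)
rewrite !osignU1 //; set s := osign i K; set t := osign j K.
have [h|h|/val_inj h] := ltngtP i j; last by rewrite h eqxx in ij.
  by rewrite /= expr1 expr0; ring.
by rewrite /= expr1 expr0; ring.
Qed.

(** The canonical anticommutation relation. For [i = j], one of the two products keeps the sets
    containing [j] and the other keeps the rest; for distinct indices exactly one sign flips. *)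
Lemma cre_ann i j u : cre j (ann i u) = (i == j)%:R *: u - ann i (cre j u).
Proof.
apply/ffunP => K; rewrite !ffunE !inE.
have [<-{j}|ij] := eqVneq i j.
  rewrite !scale1r /=; case: ifP => iK.
    rewrite subr0 finset.setD1K // mulrA -[X in _ * X * _]osign_id finset.setD1K //.
    by rewrite osign_sqr mul1r.
  by rewrite osign_id finset.setU1K ?iK // mulrA osign_sqr mul1r subrr.
rewrite scale0r add0r /=.
have [jK|jK] := boolP (j \in K); last by rewrite mulr0 if_same oppr0.
have [iK|iK] := boolP (i \in K); first by rewrite mulr0 oppr0.
have -> : (i |: K) :\ j = i |: (K :\ j).
  by apply/finset.setP => x; rewrite !inE; case: (eqVneq x i) => [->|] //; rewrite ij.
rewrite osignU1 // -[in osign i K](finset.setD1K jK) osignU1 ?inE ?eqxx //.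
have [h|h|/val_inj h] := ltngtP i j; last by rewrite h eqxx in ij.
  by rewrite /= expr1 expr0; ring.
by rewrite /= expr1 expr0; ring.
Qed.

Definition dotf u v : R := \sum_K u K * v K.

(** Deleting [j] is a bijection from the sets containing [j] onto those avoiding it, and it
    preserves the sign. *)
Lemma dotf_ann j u v : dotf (ann j u) v = dotf u (cre j v).
Proof.
rewrite /dotf (bigID (fun K => j \in K)) /= big1 ?add0r; last first.
  by move=> K jK; rewrite !ffunE jK mul0r.
rewrite [RHS](bigID (fun K => j \in K)) /= [X in _ = _ + X]big1 ?addr0; last first.
  by move=> K jK; rewrite !ffunE (negbTE jK) mulr0.
rewrite (reindex_onto (fun K => K :\ j) (fun K => j |: K)) /=; last first.
  by move=> K jK; rewrite finset.setU1K.
apply: eq_big => [K|K /andP[_ /eqP h]].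
  rewrite !inE eqxx /=; apply/eqP/idP => [<-|]; first by rewrite !inE eqxx.
  exact: finset.setD1K.
have jK : j \in K by rewrite -h !inE eqxx.
by rewrite !ffunE !inE eqxx /= jK h -[in RHS]h osign_id h; ring.
Qed.

(** Each [cre j (ann j u)] keeps exactly the coefficients on sets containing [j], so the sum counts
    the elements of [K]. *)
Lemma number_op u K : (\sum_j cre j (ann j u)) K = #|K|%:R * u K.
Proof.
rewrite sum_ffunE -sum1_card natr_sum mulr_suml [RHS]big_mkcond /=.
apply: eq_bigr => j _; rewrite !ffunE !inE eqxx /=; case: ifP => jK //.
by rewrite finset.setD1K // mulrA -[X in _ * X * _]osign_id finset.setD1K // osign_sqr.
Qed.

Definition annv a u : fock := \sum_j a 0 j *: ann j u.
Definition crev a u : fock := \sum_j a 0 j *: cre j u.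

Lemma annv_is_linear a : linear (annv a).
Proof.
move=> c u v; rewrite /annv scaler_sumr -big_split; apply: eq_bigr => j _ /=.
by rewrite linearP scalerDr !scalerA mulrC.
Qed.
HB.instance Definition _ a := GRing.isLinear.Build R fock fock *:%R (annv a)
  (annv_is_linear a).

Lemma crev_is_linear a : linear (crev a).
Proof.
move=> c u v; rewrite /crev scaler_sumr -big_split; apply: eq_bigr => j _ /=.
by rewrite linearP scalerDr !scalerA mulrC.
Qed.
HB.instance Definition _ a := GRing.isLinear.Build R fock fock *:%R (crev a)
  (crev_is_linear a).

Lemma annvD a b u : annv (a + b) u = annv a u + annv b u.
Proof. by rewrite /annv -big_split; apply: eq_bigr => j _; rewrite mxE scalerDl. Qed.

Lemma annvZ c a u : annv (c *: a) u = c *: annv a u.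
Proof. by rewrite /annv scaler_sumr; apply: eq_bigr => j _; rewrite mxE scalerA. Qed.

Lemma annv_delta j u : annv (delta_mx 0 j) u = ann j u.
Proof.
rewrite /annv (bigD1 j) //= big1 ?addr0 => [|i ij]; rewrite mxE ?eqxx ?scale1r //.
by rewrite (negbTE ij) scale0r.
Qed.

Lemma annv_ann a j u : annv a (ann j u) = - ann j (annv a u).
Proof.
rewrite /annv linear_sum -sumrN; apply: eq_bigr => i _ /=.
by rewrite linearZ ann_ann scalerN.
Qed.

Lemma crev_ann a j u : crev a (ann j u) = a 0 j *: u - ann j (crev a u).
Proof.
rewrite /crev linear_sum.
rewrite (eq_bigr (fun i => a 0 i *: ((j == i)%:R *: u) - ann j (a 0 i *: cre i u))).
  rewrite big_split sumrN; congr (_ - _).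
  rewrite (bigD1 j) //= eqxx scale1r big1 ?addr0 // => i ij.
  by rewrite [j == i]eq_sym (negbTE ij) scale0r scaler0.
by move=> i _; rewrite cre_ann scalerBr annZ.
Qed.

(** With [a = b] and both [annv a u] and [crev a u] zero, it gives [|a|^2 u = 0]; this is how a
    vector is later shown to vanish. *)
Lemma crev_annv a b u :
  crev a (annv b u) = (\sum_j a 0 j * b 0 j) *: u - annv b (crev a u).
Proof.
rewrite /annv linear_sum scaler_suml -sumrB; apply: eq_bigr => j _ /=.
by rewrite linearZ /= crev_ann scalerBr scalerA [b 0 j * _]mulrC.
Qed.

End Fock.

(** * Orthogonal projections and multivectors tangent to their range *)

Lemma mxtrace_idempotent (F : fieldType) (n : nat) (P : 'M[F]_n) :
  P *m P = P -> \tr P = (\rank P)%:R.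
Proof.
move=> PP; rewrite -[in LHS](mulmx_base P) mxtrace_mulC.
(* In the full-rank factorization [P = C B], idempotence reads [C (B C) B = C B]; cancelling [C] and
   [B] leaves [B C = 1]. *)
suff -> : row_base P *m col_base P = 1%:M by rewrite mxtrace1.
apply: (row_full_inj (col_base_full P)); apply: (row_free_inj (row_base_free P)).
change (col_base P *m (row_base P *m col_base P) *m row_base P =
  col_base P *m 1%:M *m row_base P).
by rewrite mulmx1 (mulmxA (col_base P) (row_base P)) mulmx_base -(mulmxA P) mulmx_base PP.
Qed.

Section ProjectionAlgebra.
Variables (R : realFieldType) (n : nat) (P : 'M[R]_n).
Hypotheses (Psym : P^T = P) (Pidem : P *m P = P).
Implicit Types (t u : fock R n) (M : 'M[R]_n).

Let PE i j : P i j = P j i. Proof. by rewrite -[in LHS]Psym mxE. Qed.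

(** A covector [a] with [a *m P^T = 0] is orthogonal to the plane. Membership in the exterior
    algebra of the plane is thus expressed by linear equations, which suit almost everywhere
    arguments. *)
Definition tangent_to t := forall a : 'rV[R]_n, a *m P^T = 0 -> annv a t = 0.

(** The covector [e_j] minus its projection is orthogonal to the plane, so contracting with it gives
    0. *)
Lemma ann_tangent t j : tangent_to t -> ann j t = annv (row j P) t.
Proof.
move=> tan; apply/eqP; rewrite -subr_eq0 -annv_delta -[- annv _ _]scaleN1r -annvZ -annvD.
apply/eqP/tan; rewrite mulmxDl rowE -scalemxAl -mulmxA Psym Pidem scaleN1r.
exact: subrr.
Qed.

(** Both contractions see only the projected indices, so a bilinear form [M] acts on [t] through its
    restriction [P *m M *m P] to the plane. *)
Lemma contract_proj t M : tangent_to t ->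
  \sum_l \sum_j M l j *: ann j (ann l t) =
  \sum_a \sum_b (P *m M *m P) a b *: ann b (ann a t).
Proof.
move=> tan.
have annE l j : ann j (ann l t) = \sum_a \sum_b (P l a * P j b) *: ann b (ann a t).
  rewrite (ann_tangent l tan) /annv linear_sum; apply: eq_bigr => a _ /=.
  rewrite annZ ann_ann (ann_tangent j tan) /annv linear_sum -sumrN scaler_sumr.
  apply: eq_bigr => b _; rewrite !mxE linearZ /= ann_ann -scalerN opprK.
  by rewrite scalerA.
under eq_bigr do under eq_bigr do rewrite annE scaler_sumr.
under eq_bigr do under eq_bigr do under eq_bigr do rewrite scaler_sumr.
rewrite (eq_bigr (fun l => \sum_a \sum_j \sum_b (M l j) *: ((P l a * P j b) *: ann b (ann a t)))); last first.
  by move=> l _; rewrite exchange_big.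
rewrite exchange_big; apply: eq_bigr => a _ /=.
rewrite (eq_bigr (fun l => \sum_b \sum_j (M l j) *: ((P l a * P j b) *: ann b (ann a t)))); last first.
  by move=> l _; rewrite exchange_big.
rewrite exchange_big; apply: eq_bigr => b _ /=.
rewrite mxE scaler_suml exchange_big; apply: eq_bigr => j _ /=.
rewrite mxE mulr_suml scaler_suml; apply: eq_bigr => l _ /=.
by rewrite scalerA (PE a l); congr (_ *: _); ring.
Qed.

(** A symmetric coefficient against anticommuting operators: exchanging the indices turns the sum
    into its opposite. *)
Lemma contract_sym t M : tangent_to t -> (P *m M *m P)^T = P *m M *m P ->
  \sum_l \sum_j M l j *: ann j (ann l t) = 0.
Proof.
move=> tan; rewrite (contract_proj M tan); move: (P *m M *m P) => N Nsym.
set S := LHS; suff : S = - S by move/eqP; rewrite -addr_eq0 -mulr2n -scaler_nat scaler_eq0 pnatr_eq0 /= => /eqP.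
rewrite {1}/S exchange_big -sumrN; apply: eq_bigr => a _ /=.
rewrite -sumrN; apply: eq_bigr => b _ /=.
by rewrite ann_ann scalerN -[in LHS]Nsym mxE.
Qed.

Lemma dotf_ge0 u : 0 <= dotf u u.
Proof. by apply: sumr_ge0 => K _; rewrite -expr2 sqr_ge0. Qed.

Lemma dotf_eq0 u : dotf u u = 0 -> u = 0.
Proof.
move/eqP; rewrite /dotf psumr_eq0 => [|K _]; last by rewrite -expr2 sqr_ge0.
move=> /allP h; apply/ffunP => K; rewrite ffunE; apply/eqP.
by have := h K (mem_index_enum _); rewrite /= -expr2 sqrf_eq0.
Qed.

Lemma dotfZl (c : R) u t : dotf (c *: t) u = c * dotf t u.
Proof. by rewrite /dotf mulr_sumr; apply: eq_bigr => K _; rewrite ffunE -mulrA. Qed.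

Lemma dotf_sum (F : 'I_n -> fock R n) u : dotf (\sum_i F i) u = \sum_i dotf (F i) u.
Proof.
rewrite /dotf exchange_big; apply: eq_bigr => K _ /=.
by rewrite sum_ffunE mulr_suml.
Qed.

Lemma dotfC u t : dotf u t = dotf t u.
Proof. by apply: eq_bigr => K _; rewrite mulrC. Qed.

(* On vectors of degree [\rank P] the number operator is
   [\tr P - \sum_j ann_j cre_(P e_j)], so the last sum vanishes on [t]; its
   expectation in the state [t] is a sum of squares. *)
Lemma crev_tangent t c : tangent_to t ->
  (forall K : {set 'I_n}, #|K| != \rank P -> t K = 0) -> crev (row c P) t = 0.
Proof.
move=> tan deg.
have num : \sum_j cre j (ann j t) = (\rank P)%:R *: t.
  apply/ffunP => K; rewrite number_op ffunE.
  by have [->//|/deg ->] := eqVneq #|K| (\rank P); rewrite mulr0 scaler0.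
have S0 : \sum_j \sum_a P j a *: ann a (cre j t) = 0.
  move: num; rewrite -(mxtrace_idempotent Pidem).
  under eq_bigr => j _.
    rewrite (ann_tangent j tan) /annv linear_sum /=.
    under eq_bigr do rewrite mxE linearZ /= cre_ann scalerBr scalerA.
    rewrite sumrB (bigD1 j) //= eqxx mulr1 big1 ?addr0; last first.
      by move=> i ij; rewrite (negbTE ij) mulr0 scale0r.
  over.
  rewrite sumrB -scaler_suml => /eqP; rewrite -subr_eq0 addrAC subrr add0r oppr_eq0.
  by move/eqP.
have : \sum_b dotf (crev (row b P) t) (crev (row b P) t) = 0.
  transitivity (dotf (\sum_j \sum_a P j a *: ann a (cre j t)) t); last first.
    by rewrite S0 /dotf big1 // => K _; rewrite ffunE mul0r.
  rewrite dotf_sum.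
  under [RHS]eq_bigr do (rewrite dotf_sum; under eq_bigr do rewrite dotfZl dotf_ann).
  under [LHS]eq_bigr => b _.
    rewrite {1}/crev dotf_sum.
    under eq_bigr => i _.
      rewrite dotfZl dotfC /crev dotf_sum mulr_sumr.
      under eq_bigr do rewrite dotfZl dotfC mulrA !mxE.
    over.
  over.
  rewrite exchange_big; apply: eq_bigr => i _ /=.
  rewrite exchange_big; apply: eq_bigr => j _ /=.
  rewrite -mulr_suml -[in RHS]Pidem mxE; congr (_ * _).
  by apply: eq_bigr => b _; rewrite (PE i b).
move/eqP; rewrite psumr_eq0 => [/allP h|b _]; last exact: dotf_ge0.
by apply: dotf_eq0; apply/eqP; exact: (h c (mem_index_enum _)).
Qed.

(** Write [N] for [P *m M *m P], take a row [x] of [P] and put [y = x *m (N^T - N)]. Creation along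
    [x] and along [y] kills [t]. Moving creation along [x] through the two annihilators of the
    vanishing sum leaves exactly [annv y t = 0]; then [crev_annv] gives [|y|^2 t = 0], hence
    [y = 0]. These [y] are the rows of [N^T - N]. *)
Lemma contract_eq0_sym t M : tangent_to t -> t != 0 ->
  (forall K : {set 'I_n}, #|K| != \rank P -> t K = 0) ->
  \sum_l \sum_j M l j *: ann j (ann l t) = 0 ->
  (P *m M *m P)^T = P *m M *m P.
Proof.
move=> tan t0 deg; rewrite (contract_proj M tan).
set N := P *m M *m P => NW.
have PN : P *m N = N by rewrite /N !mulmxA Pidem.
have NP : N *m P = N by rewrite /N -!mulmxA Pidem.
have PNT : P *m N^T = N^T by rewrite -{1}Psym -trmx_mul NP.
have NTP : N^T *m P = N^T by rewrite -{1}Psym -trmx_mul PN.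
(* A vector of the plane is a combination of rows of [P], to which [crev_tangent] applies. *)
have crevP (y : 'rV[R]_n) : y *m P = y -> crev y t = 0.
  move=> yP; rewrite /crev -yP.
  under eq_bigr do rewrite mxE scaler_suml.
  rewrite exchange_big big1 // => b _ /=.
  transitivity (y 0 b *: crev (row b P) t); last by rewrite crev_tangent // scaler0.
  rewrite /crev scaler_sumr.
  by apply: eq_bigr => j _; rewrite mxE scalerA.
apply/eqP; rewrite -subr_eq0; apply/eqP.
have <- : P *m (N^T - N) = N^T - N by rewrite mulmxBr PNT PN.
apply/row_matrixP => c; rewrite row0 row_mul.
set x := row c P; set y := x *m (N^T - N).
have cx : crev x t = 0 by exact: crev_tangent.
have cy : crev y t = 0.
  by apply: crevP; rewrite /y -mulmxA mulmxBl NTP NP.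
have ay : annv y t = 0.
  have : crev x (\sum_a \sum_b N a b *: ann b (ann a t)) = 0 by rewrite NW linear0.
  rewrite linear_sum /=.
  under eq_bigr => a _.
    rewrite linear_sum /=.
    under eq_bigr do rewrite linearZ /= !crev_ann cx linear0 subr0 linearZ /= scalerBr !scalerA.
    rewrite sumrB.
  over.
  rewrite sumrB => h; rewrite /annv -[RHS]h /y mulmxBr.
  under eq_bigr do rewrite mxE scalerDl.
  rewrite big_split /=; congr (_ + _).
    apply: eq_bigr => a _; rewrite mxE scaler_suml; apply: eq_bigr => b _.
    by rewrite [N^T _ _]mxE mulrC.
  rewrite exchange_big -sumrN; apply: eq_bigr => b _ /=.
  rewrite !mxE scaleNr scaler_suml; congr (- _); apply: eq_bigr => a _.
  by rewrite mulrC.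
have : crev y (annv y t) = 0 by rewrite ay linear0.
rewrite crev_annv cy linear0 subr0 => /eqP; rewrite scaler_eq0 (negbTE t0) orbF.
rewrite psumr_eq0 => [/allP h|j _]; last by rewrite -expr2 sqr_ge0.
apply/rowP => j; rewrite [RHS]mxE; apply/eqP.
by have := h j (mem_index_enum _); rewrite /= -expr2 sqrf_eq0.
Qed.

End ProjectionAlgebra.

(** * Increasing enumeration of an index set and deletion of one element *)

Section SortedEnum.
Variable n : nat.
Implicit Types (K : {set 'I_n}) (i j : 'I_n).

Lemma enum_set_sorted K : sorted (fun i j : 'I_n => (i < j)%N) (enum K).
Proof.
rewrite -(@sorted_map _ _ val ltn).
apply: (subseq_sorted ltn_trans _ (iota_ltn_sorted 0 n)).
rewrite -val_enum_ord map_subseq // {1}/enum_mem -enumT.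
exact: filter_subseq.
Qed.

(** Turns the cofactor sign, which depends on the position [b] of a column, into [osign], which
    counts smaller elements. *)
Lemma card_lt_nth_enum K j b : (b < #|K|)%N ->
  #|[set i in K | (i < nth j (enum K) b)%N]| = b.
Proof.
move=> bK; set x := nth _ _ _.
have sz : size (enum K) = #|K| by rewrite cardE.
have ltr : transitive (fun i j : 'I_n => (i < j)%N) by move=> ? ? ?; exact: ltn_trans.
have mono c d : (c < #|K|)%N -> (d < #|K|)%N -> (c < d)%N ->
    (nth j (enum K) c < nth j (enum K) d)%N.
  by move=> cK dK; apply: (sorted_ltn_nth ltr j (enum_set_sorted K)); rewrite inE sz.
have <- : [set nth j (enum K) c | c : 'I_b]%SET = [set i in K | (i < x)%N]%SET.
  apply/setP => i; rewrite !inE; apply/imsetP/andP => [[c _ ->]|[iK ix]].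
    have cK : (c < #|K|)%N by apply: ltn_trans bK.
    by split; [rewrite -mem_enum mem_nth // sz | exact: mono].
  have iK' : (index i (enum K) < #|K|)%N by rewrite -sz index_mem mem_enum.
  have ib : (index i (enum K) < b)%N.
    rewrite ltnNge; apply/negP => bi; move: ix; rewrite /x ltnNge => /negP; apply.
    rewrite -[X in (_ <= nat_of_ord X)%N](nth_index j (s := enum K)) ?mem_enum //.
    move: bi; rewrite leq_eqVlt => /orP[/eqP <- //|bi].
    exact/ltnW/mono.
  by exists (Ordinal ib) => //=; rewrite nth_index ?mem_enum.
rewrite card_imset ?card_ord // => c d /eqP.
have lt e : (e < b)%N -> (e < #|K|)%N by move=> /ltn_trans; exact.
by rewrite nth_uniq ?enum_uniq ?sz ?lt // => /eqP/val_inj.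
Qed.

(** Deleting the element of rank [b] skips that position, exactly as a cofactor skips its column. *)
Lemma nth_enum_setD1 K j b c : (b < #|K|)%N ->
  nth j (enum (K :\ nth j (enum K) b)) c = nth j (enum K) (bump b c).
Proof.
move=> bK; have sz : size (enum K) = #|K| by rewrite cardE.
set x := nth j (enum K) b.
have -> : enum (K :\ x) = rem x (enum K).
  rewrite rem_filter ?enum_uniq // /enum_mem -filter_predI; apply: eq_filter => i.
  by rewrite /= !inE.
rewrite remE /x index_uniq ?enum_uniq ?sz // nth_cat size_take sz bK.
case: ltnP => cb; first by rewrite nth_take // /bump leqNgt cb.
by rewrite nth_drop /bump cb addSn subnKC // add1n.
Qed.

End SortedEnum.

Local Open Scope classical_set_scope.
Local Open Scope ring_scope.

(** * Spans of multivectors *)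

Section Hvec.
Variables (R : realType) (n : nat).

(** Extension by zero: [insub] yields [None] on sets whose cardinality is not [h]. *)
Definition hext h (v : hvec R n h) : fock R n :=
  [ffun K : {set 'I_n} => oapp v 0 (insub K : option (mindex n h))].

Lemma hextE h (v : hvec R n h) (I : mindex n h) : hext v (val I) = v I.
Proof. by rewrite ffunE valK. Qed.

Lemma hext_out h (v : hvec R n h) (K : {set 'I_n}) : #|K| != h -> hext v K = 0.
Proof. by move=> Kh; rewrite ffunE insubN. Qed.

Lemma hext_inj h : injective (@hext h).
Proof. by move=> v v' e; apply: funext => I; rewrite -hextE e hextE. Qed.

Lemma mi_nthE h (I : mindex n h) (b : 'I_h) j : mi_nth I b = nth j (enum (val I)) b.
Proof. by rewrite /mi_nth (enum_val_nth j). Qed.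

(** Laplace expansion of the minor along its first row; the cofactor attached to [j] is the minor on
    [K :\ j]. *)
Lemma hext_wedgeS h (w : 'I_h.+1 -> 'rV[R]_n) :
  hext (wedge w) = crev (w ord0) (hext (wedge (fun a => w (lift ord0 a)))).
Proof.
apply/ffunP => K; rewrite /crev sum_ffunE.
have [Kh|Kh] := eqVneq #|K| h.+1; last first.
  rewrite hext_out // big1 // => j _; rewrite !ffunE /=.
  case: ifP => jK; last by rewrite scaler0.
  rewrite insubN ?mulr0 ?scaler0 //.
  by apply: contra Kh => /eqP <-; rewrite [X in X == _](cardsD1 j) jK.
pose I : mindex n h.+1 := Sub K (introT eqP Kh).
rewrite -[K in LHS]/(val I) hextE /wedge (expand_det_row _ ord0).
(* Only indices of [K] contribute, and their increasing enumeration matches them with the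
   columns. *)
rewrite [RHS](bigID (mem K)) /= [X in _ = _ + X]big1 ?addr0; last first.
  by move=> j jK; rewrite !ffunE (negbTE jK) scaler0.
rewrite [RHS]big_enum_val [RHS](reindex (cast_ord (esym Kh))) /=; last first.
  by exists (cast_ord Kh) => ? _; rewrite ?cast_ordK ?cast_ordKV.
apply: eq_bigr => b _; rewrite !mxE.
have jE : enum_val (cast_ord (esym Kh) b) = mi_nth I b by rewrite /mi_nth; congr (enum_val _); exact: val_inj.
have jK : mi_nth I b \in K by rewrite -jE; exact: enum_valP.
rewrite jE; set j := mi_nth I b; rewrite [in RHS]ffunE [in RHS]ffunE jK.
have jn : j = nth j (enum K) b by rewrite {1}/j (mi_nthE _ _ j).
have bK : (b < #|K|)%N by rewrite Kh.
have Kjh : #|K :\ j| == h.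
  by rewrite -eqSS -Kh [X in _ == X](cardsD1 j) jK.
pose I' : mindex n h := Sub (K :\ j) Kjh.
rewrite -[X in hext _ X]/(val I') hextE /cofactor add0n.
congr (_ * (_ * _)).
  by rewrite /osign [in RHS]jn card_lt_nth_enum.
congr (\det _); apply/matrixP => a c; rewrite !mxE; congr (w _ _ _).
rewrite (mi_nthE I _ j) (mi_nthE I' _ j) /=.
by have := nth_enum_setD1 j c bK; rewrite -jn => ->.
Qed.


Lemma ann_deg h j (u : fock R n) : (forall K : {set 'I_n}, #|K| != h.+1 -> u K = 0) ->
  forall K : {set 'I_n}, #|K| != h -> ann j u K = 0.
Proof.
move=> deg K Kh; rewrite ffunE; case: ifP => // jK.
by rewrite deg ?mulr0 // cardsU1 jK add1n eqSS.
Qed.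

Lemma ann_deg0 j (u : fock R n) : (forall K : {set 'I_n}, #|K| != 0%N -> u K = 0) ->
  ann j u = 0.
Proof.
move=> deg; apply/ffunP => K; rewrite [RHS]ffunE ffunE; case: ifP => // jK.
by rewrite deg ?mulr0 // cardsU1 jK.
Qed.

(** Contraction anticommutes with multiplication by the first factor up to their scalar product,
    which is 0; induct on the remaining factors. *)
Lemma annv_wedge h (w : 'I_h -> 'rV[R]_n) (a : 'rV[R]_n) :
  (forall b, \sum_j w b 0 j * a 0 j = 0) -> annv a (hext (wedge w)) = 0.
Proof.
elim: h w => [|h IH] w wa.
  by rewrite /annv big1 // => j _; rewrite ann_deg0 ?scaler0 // => K; exact: hext_out.
have := crev_annv (w ord0) a (hext (wedge (fun b => w (lift ord0 b)))).
rewrite -hext_wedgeS wa scale0r sub0r IH ?linear0 //.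
by move/esym/eqP; rewrite oppr_eq0 => /eqP.
Qed.

Lemma hext_sum h m (c : 'I_m -> R) (v : 'I_m -> hvec R n h) :
  hext (fun I => \sum_(j < m) c j * v j I) = \sum_(j < m) c j *: hext (v j).
Proof.
apply/ffunP => K; rewrite sum_ffunE ffunE; case: insubP => [I _ <-|Kh] /=.
  by apply: eq_bigr => j _; rewrite ffunE hextE.
by rewrite big1 // => j _; rewrite ffunE hext_out ?scaler0.
Qed.

Lemma dot_mx (a b : 'rV[R]_n) : \sum_j a 0 j * b 0 j = (b *m a^T) 0 0.
Proof. by rewrite mxE; apply: eq_bigr => j _; rewrite mxE mulrC. Qed.

Lemma in_Lambda_annv h (W : 'M[R]_n) (v : hvec R n h) (a : 'rV[R]_n) :
  in_Lambda W v -> a *m W^T = 0 -> annv a (hext v) = 0.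
Proof.
move=> [m [c [w [wW ->]]]] aW; rewrite hext_sum linear_sum big1 // => j _ /=.
rewrite linearZ /= annv_wedge ?scaler0 // => b.
have /submxP[y ->] := wW j b.
by rewrite dot_mx trmx_mul mulmxA aW mul0mx mxE.
Qed.

Definition in_LambdaF h (W : 'M[R]_n) (u : fock R n) :=
  exists2 v : hvec R n h, in_Lambda W v & u = hext v.

Lemma in_LambdaF_sum h (W : 'M[R]_n) m (c : 'I_m -> R) (u : 'I_m -> fock R n) :
  (forall j, in_LambdaF h W (u j)) -> in_LambdaF h W (\sum_j c j *: u j).
Proof.
elim: m c u => [|m IH] c u uW.
  rewrite big_ord0; exists (fun=> 0); last first.
    by apply/ffunP => K; rewrite !ffunE; case: insub.
  exists 0%N, (fun=> 0), (fun _ _ => 0); split; first by case.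
  by apply: funext => I; rewrite big_ord0.
rewrite big_ord_recl.
have [v1 [m1 [c1 [w1 [w1W ->]]]] ->] := uW ord0.
have [v2 [m2 [c2 [w2 [w2W ->]]]] ->] := IH (c \o lift ord0) _ (fun j => uW (lift ord0 j)).
pose c3 (j : 'I_(m1 + m2)) := match fintype.split j with inl i => c ord0 * c1 i | inr i => c2 i end.
pose w3 (j : 'I_(m1 + m2)) := match fintype.split j with inl i => w1 i | inr i => w2 i end.
exists (fun I => \sum_j c3 j * wedge (w3 j) I).
  by exists (m1 + m2)%N, c3, w3; split=> // j b; rewrite /w3; case: fintype.split.
rewrite !hext_sum big_split_ord scaler_sumr /=; congr (_ + _); apply: eq_bigr => j _.
  by rewrite /c3 /w3 -[lshift m2 j]/(unsplit (inl j)) unsplitK scalerA.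
by rewrite /c3 /w3 -[rshift m1 j]/(unsplit (inr j)) unsplitK.
Qed.

Lemma in_LambdaF_crev h (W : 'M[R]_n) (x : 'rV[R]_n) u :
  (x <= W)%MS -> in_LambdaF h W u -> in_LambdaF h.+1 W (crev x u).
Proof.
move=> xW [v [m [c [w [wW ->]]]] ->].
pose w' j (a : 'I_h.+1) := if unlift ord0 a is Some b then w j b else x.
exists (fun I => \sum_j c j * wedge (w' j) I).
  exists m, c, w'; split=> // j a; rewrite /w'; case: unlift => // *; exact: wW.
rewrite !hext_sum linear_sum; apply: eq_bigr => j _ /=.
have w'0 : w' j ord0 = x by rewrite /w' unlift_none.
have w'S : (fun a => w' j (lift ord0 a)) = w j.
  by apply: funext => a; rewrite /w' liftK.
by rewrite linearZ /= hext_wedgeS w'0 w'S.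
Qed.

(** By the number operator, [(h+1) u] is the sum of the [e_j /\ ann_j u]. Tangency replaces [ann_j]
    by contraction with [P e_j], and symmetry moves [P] onto the created vector. So [u] is a
    combination of products of rows of [P] with the [ann_a u], which are tangent of degree [h]. *)
Lemma tangent_in_LambdaF h (P : 'M[R]_n) (u : fock R n) :
  P^T = P -> P *m P = P -> tangent_to P u ->
  (forall K : {set 'I_n}, #|K| != h -> u K = 0) -> in_LambdaF h P u.
Proof.
move=> Psym Pidem; elim: h u => [|h IH] u tan deg.
  exists (fun=> u finset.set0); last first.
    apply/ffunP => K; rewrite ffunE; case: insubP => [I|] /=.
      by rewrite cards_eq0 => /eqP ->.
    exact: deg.
  (* In degree 0 a scalar is itself times the empty determinant, which is 1. *)
  exists 1%N, (fun=> u finset.set0), (fun _ _ => 0); split; first by move=> *; exact: sub0mx.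
  by apply: funext => I; rewrite big_ord1 /wedge det_mx00 mulr1.
have h0 : (h.+1%:R : R) != 0 by rewrite pnatr_eq0.
suff -> : u = \sum_a h.+1%:R^-1 *: crev (row a P) (ann a u).
  apply: in_LambdaF_sum => a; apply: in_LambdaF_crev; first exact: row_sub.
  apply: IH => [b bP|]; first by rewrite annv_ann tan ?linear0 ?oppr0.
  exact: ann_deg.
rewrite -scaler_sumr; apply: (scalerI h0); rewrite scalerA divff // scale1r.
transitivity (\sum_j cre j (ann j u)).
  apply/ffunP => K; rewrite number_op ffunE.
  by have [->//|/deg ->] := eqVneq #|K| h.+1; rewrite mulr0 scaler0.
under eq_bigr do rewrite (ann_tangent Psym Pidem _ tan) /annv linear_sum.
rewrite exchange_big; apply: eq_bigr => a _ /=.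
rewrite /crev; apply: eq_bigr => j _.
by rewrite linearZ !mxE -[P in LHS]Psym mxE.
Qed.

Lemma tangent_spanv h (P : 'M[R]_n) (v : hvec R n h) :
  P^T = P -> P *m P = P -> tangent_to P (hext v) ->
  spanv v `<=` rowspace_set P.
Proof.
move=> Psym Pidem tan u; apply.
have [v' v'P /hext_inj->//] := tangent_in_LambdaF (h := h) Psym Pidem tan (@hext_out _ _).
Qed.

(** For fixed [K] the coefficient of the contraction with [a] is the scalar product of [a] with a
    vector [b]. Every [W] carrying [v] contains [b], since covectors orthogonal to [W] kill [v]; so
    [b] lies in the span, hence in the plane. This never requires [v] to be carried by the span
    itself. *)
Lemma spanv_tangent h (P : 'M[R]_n) (v : hvec R n h) :
  spanv v `<=` rowspace_set P -> tangent_to P (hext v).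
Proof.
move=> vP a aP; apply/ffunP => K; rewrite [RHS]ffunE.
pose b : 'rV[R]_n := \row_j ann j (hext v) K.
have bE (x : 'rV[R]_n) : annv x (hext v) K = (x *m b^T) 0 0.
  rewrite /annv sum_ffunE mxE; apply: eq_bigr => j _.
  by rewrite [LHS]ffunE !mxE.
have /submxP[y bP] : (b <= P)%MS.
  apply: vP => W vW; rewrite submxE; apply/eqP/rowP => c.
  (* The columns of the cokernel matrix generate the covectors orthogonal to [W]. *)
  pose x := (col c (cokermx W))^T.
  have : annv x (hext v) K = 0.
    rewrite (in_Lambda_annv vW) ?ffunE //.
    by rewrite /x -trmx_mul colE mulmxA mulmx_coker mul0mx trmx0.
  rewrite bE mxE => sum0; rewrite [RHS]mxE [LHS]mxE -[RHS]sum0.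
  by apply: eq_bigr => j _; rewrite !mxE mulrC.
by rewrite bE bP trmx_mul mulmxA aP mul0mx mxE.
Qed.

End Hvec.

(** * Functions of class C^1, smooth functions and bump functions *)

Section PartialDerivatives.
Variables (R : realType) (n : nat).
Notation V := 'rV[R]_n.
Notation e := (evec R).
Implicit Types (f g : V -> R) (O : set V) (x v y : V).

Lemma ballP x y r : 0 < r -> (forall i, `|x 0 i - y 0 i| < r) <-> ball x r y.
Proof.
move=> r0; split=> [xy|[_ xy] i]; last exact: (xy 0 i).
by split=> // i j; rewrite ord1; exact: xy.
Qed.

Lemma is_derive_line f x v y (s d : R) : y = s *: v + x ->
  is_derive y v f d -> is_derive s (1 : R) (fun t : R => f (t *: v + x)) d.
Proof.
move=> ->{y} [fd <-].
have E : (fun h : R => h^-1 *: (((fun t : R => f (t *: v + x)) \o shift s) (h *: (1:R)) - f (s *: v + x)))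
  = (fun h : R => h^-1 *: ((f \o shift (s *: v + x)) (h *: v) - f (s *: v + x))).
  apply: funext => h /=; congr (_ *: (f _ - _)).
  by rewrite [h *: 1]mulr1 scalerDl addrA.
by split; [rewrite /derivable E | rewrite /derive E].
Qed.

(** The relative parameter [th] makes one statement serve both signs of [t] and [t = 0]. *)
Lemma MVT_line f x v (t : R) :
  (forall th, 0 <= th <= 1 -> derivable f ((th * t) *: v + x) v) ->
  exists2 th, 0 <= th <= 1 & f (t *: v + x) - f x = t * 'D_v f ((th * t) *: v + x).
Proof.
move=> df.
have itv (a b : R) : a <= b -> (forall s, s \in `[a, b] -> derivable f (s *: v + x) v) ->
    exists2 s, s \in `[a, b] & f (b *: v + x) - f (a *: v + x) = 'D_v f (s *: v + x) * (b - a).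
  move=> ab sub.
  have dl s : s \in `[a, b] -> is_derive s (1 : R) (fun t : R => f (t *: v + x)) ('D_v f (s *: v + x)).
    by move=> /sub /derivableP; exact: is_derive_line.
  pose g := fun t : R => f (t *: v + x).
  pose dg := fun s : R => 'D_v f (s *: v + x).
  have gd s : s \in `]a, b[%R -> is_derive s 1 g (dg s).
    by move=> sab; apply: dl; exact: subset_itv_oo_cc.
  have gc : {within `[a, b], continuous g}.
    by apply: derivable_within_continuous => s /dl[].
  exact: (MVT_segment ab gd gc).
have [t0|t0|->] := ltgtP t 0.
- have th01 s : s \in `[t, 0] -> 0 <= s / t <= 1.
    rewrite in_itv /= => /andP[ts s0].
    by rewrite ler_ndivlMr // ler_ndivrMr // mul0r mul1r s0.
  have sE s : s = s / t * t by rewrite divfK // lt_eqF.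
  have [s /th01 ?|s sab] := itv t 0 (ltW t0); first by rewrite (sE s); exact: df.
  rewrite scale0r add0r sub0r => E; exists (s / t); first exact: th01.
  by rewrite -sE -opprB E mulrN opprK mulrC.
- have th01 s : s \in `[0, t] -> 0 <= s / t <= 1.
    rewrite in_itv /= => /andP[s0 st].
    by rewrite ler_pdivlMr // ler_pdivrMr // mul0r mul1r s0.
  have sE s : s = s / t * t by rewrite divfK // gt_eqF.
  have [s /th01 ?|s sab] := itv 0 t (ltW t0); first by rewrite (sE s); exact: df.
  rewrite scale0r add0r subr0 mulrC => E; exists (s / t); first exact: th01.
  by rewrite -sE.
by exists 0; rewrite ?lexx ?ler01 // scale0r add0r subrr mul0r.
Qed.

Lemma C1_on_continuousD O f j x : open O -> C1_on O f -> O x ->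
  {for x, continuous ('D_(e j) f)}.
Proof.
move=> oO /(_ j)[_]; rewrite continuous_open_subspace // => cD Ox.
by apply: cD; rewrite inE.
Qed.

Lemma C1_onP O f : open O ->
  (forall j x, O x -> derivable f x (e j) /\ {for x, continuous ('D_(e j) f)}) ->
  C1_on O f.
Proof.
move=> oO df j; split=> [x /(df j)[]//|].
by rewrite continuous_open_subspace // => x; rewrite inE => /(df j)[].
Qed.

(** The vertices of the staircase path from 0 to [v] that changes one coordinate at a time. *)
Definition trunc_row (m : nat) v : V := \row_j if (j < m)%N then v 0 j else 0.

Lemma trunc_rowS v (m : 'I_n) : trunc_row m.+1 v = v 0 m *: e m + trunc_row m v.
Proof.
apply/rowP => j; rewrite !mxE eqxx /= ltnS leq_eqVlt eq_sym.
case: (eqVneq j m) => [->|jm] /=; first by rewrite eqxx ltnn mulr1 addr0.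
by rewrite eq_sym (_ : val j == val m = false) ?mulr0 ?add0r //; exact: negbTE.
Qed.

(** Telescope along the staircase path; on each edge the mean value theorem gives a partial
    derivative at a nearby point, within [eps] of its value at [x]. *)
Lemma C1_on_taylor O f x : open O -> C1_on O f -> O x ->
  forall eps : R, 0 < eps -> exists2 d : R, 0 < d & forall v, (forall i, `|v 0 i| < d) ->
  `|f (v + x) - f x - \sum_j v 0 j * 'D_(e j) f x| <= eps * \sum_j `|v 0 j|.
Proof.
move=> oO cf Ox eps eps0.
have : \forall y \near x, O y /\ forall j : 'I_n, `|'D_(e j) f x - 'D_(e j) f y| < eps.
  near=> y; split; first by near: y; exact: open_nbhs_nbhs.
  near: y; apply: filter_forall => j.
  have /cvgrPdist_lt h : 'D_(e j) f y @[y --> x] --> 'D_(e j) f x.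
    exact: C1_on_continuousD oO cf Ox.
  exact: h.
move=> /nbhs_ballP[d /= d0 xd]; exists d => // v vd.
(* Balls are cubes for the sup norm, so the staircase never leaves the ball. *)
have vd' s (m : 'I_n) : `|s| <= `|v 0 m| -> ball x d (s *: e m + (trunc_row m v + x)).
  move=> sv; apply/ballP => // i; rewrite !mxE eqxx /=.
  have -> a b c : a - (b + (c + a)) = - (b + c) :> R by ring.
  rewrite normrN; case: (eqVneq i m) => [->|im].
    by rewrite ltnn mulr1 addr0; exact: le_lt_trans (vd m).
  by rewrite mulr0 add0r; case: ifP => _ //; rewrite normr0.
have -> : f (v + x) - f x = \sum_(m < n) (f (trunc_row m.+1 v + x) - f (trunc_row m v + x)).
  rewrite -(big_mkord xpredT (fun m => f (trunc_row m.+1 v + x) - f (trunc_row m v + x)))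
    telescope_sumr //; congr (f (_ + _) - f _).
    by apply/rowP => j; rewrite mxE ltn_ord.
  by rewrite -[LHS]add0r; congr (_ + _); apply/rowP => j; rewrite !mxE.
rewrite -sumrB mulr_sumr; apply: (le_trans (ler_norm_sum _ _ _)).
apply: ler_sum => m _.
have ths th : 0 <= th <= 1 -> `|th * v 0 m| <= `|v 0 m|.
  by move=> /andP[th0 th1]; rewrite normrM ger0_norm // ler_piMl.
have [th /ths sv|th /ths sv E] := @MVT_line f (trunc_row m v + x) (e m) (v 0 m).
  have [Oy _] := xd _ (vd' _ m sv).
  by have [df _] := cf m; exact: df.
rewrite trunc_rowS -(addrA (v 0 m *: e m)) E -mulrBr normrM mulrC ler_wpM2r // distrC ltW //.
by have [_ ] := xd _ (vd' _ m sv); exact.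
Unshelve. all: by end_near. Qed.

Lemma C1_on_derive O f x v : open O -> C1_on O f -> O x ->
  is_derive x v f (\sum_j v 0 j * 'D_(e j) f x).
Proof.
move=> oO cf Ox; set L := \sum_j _.
suff fL : (fun h : R => h^-1 *: ((f \o shift x) (h *: v) - f x)) @ 0^' --> L.
  by split; [exact: (cvgP L) | exact: cvg_lim].
apply/cvgrPdist_le => eps eps0.
set S := \sum_j `|v 0 j|.
(* The added 1 keeps the divisor positive when [v = 0]. *)
have S0 : 0 < S + 1 by rewrite ltr_wpDl // sumr_ge0.
have [d d0 fd] := C1_on_taylor oO cf Ox (divr_gt0 eps0 S0).
near=> h.
have h0 : h != 0 by near: h; exact: nbhs_dnbhs_neq.
have hd : forall i, `|(h *: v) 0 i| < d.
  move=> i; rewrite mxE normrM.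
  have hS : `|h| * (S + 1) < d.
    rewrite -ltr_pdivlMr //; near: h; apply: dnbhs0_lt; exact: divr_gt0.
  apply: le_lt_trans hS; rewrite ler_wpM2l // /S (bigD1 i) //= -addrA lerDl.
  by rewrite addr_ge0 // sumr_ge0.
have := fd _ hd.
have -> : \sum_j (h *: v) 0 j * 'D_(e j) f x = h * L.
  by rewrite mulr_sumr; apply: eq_bigr => j _; rewrite mxE mulrA.
have -> : \sum_j `|(h *: v) 0 j| = `|h| * S.
  by rewrite mulr_sumr; apply: eq_bigr => j _; rewrite mxE normrM.
move=> hL; rewrite /= -(ler_pM2l (_ : 0 < `|h|)) ?normr_gt0 // -normrM mulrBr.
rewrite [_ *: _](_ : _ = h^-1 * (f (h *: v + x) - f x)) // mulrA divff // mul1r distrC.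
apply: (le_trans hL); rewrite mulrCA ler_wpM2l // mulrAC ler_pdivrMr //.
by rewrite ler_pM2l // lerDl.
Unshelve. all: by end_near. Qed.

Lemma C1_on_continuous O f x : open O -> C1_on O f -> O x -> {for x, continuous f}.
Proof.
move=> oO cf Ox; apply/(@cvgrPdist_le _ _ _ (nbhs x) _ f (f x)) => eps eps0.
have [d d0 fd] := C1_on_taylor oO cf Ox ltr01.
(* A local Lipschitz constant: each coordinate contributes its partial derivative and 1 for the
   Taylor remainder taken with [eps = 1]; the last 1 makes [C] positive. *)
pose C : R := \sum_(j < n) (1 + `|'D_(e j) f x|) + 1.
have C0 : 0 < C by rewrite ltr_wpDl // sumr_ge0 // => j _; rewrite addr_ge0.
have dC0 : 0 < Num.min d (eps / C) by rewrite lt_min d0 divr_gt0.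
apply/nbhs_ballP; exists (Num.min d (eps / C)) => //= y yd.
have yd' i : `|(y - x) 0 i| < Num.min d (eps / C).
  by rewrite !mxE distrC; move: i; exact/ballP.
have ydd i : `|(y - x) 0 i| < d by apply: lt_le_trans (yd' i) _; rewrite ge_min lexx.
have yde i : `|(y - x) 0 i| <= eps / C.
  by apply: le_trans (ltW (yd' i)) _; rewrite ge_min lexx orbT.
have := fd (y - x) ydd; rewrite subrK mul1r distrC => fyx.
rewrite -normrN opprB -[f y - f x](subrK (\sum_j (y - x) 0 j * 'D_(e j) f x)).
apply: le_trans (ler_normD _ _) _; rewrite -normrN opprB.
apply: le_trans (lerD fyx (ler_norm_sum _ _ _)) _; rewrite -big_split /=.
have -> : eps = eps / C * (C - 1) + eps / C by rewrite mulrBr mulr1 subrK divfK // gt_eqF.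
apply: ler_wpDr; first by rewrite ltW // divr_gt0.
rewrite addrK mulr_sumr; apply: ler_sum => j _.
by rewrite normrM mulrDr mulr1; apply: lerD => //; exact: ler_wpM2r.
Qed.

End PartialDerivatives.

Section Smooth.
Variables (R : realType) (n : nat).
Notation V := 'rV[R]_n.
Notation e := (evec R).
Implicit Types (f g : V -> R) (O : set V) (x v y : V).

Lemma continuous_eq_on O f g x : open O -> O x -> (forall y, O y -> f y = g y) ->
  {for x, continuous g} -> {for x, continuous f}.
Proof.
move=> oO Ox fg cg; rewrite /prop_for /continuous_at (fg _ Ox).
have nO : \forall y \near nbhs x, g y = f y.
  have : \forall y \near nbhs x, O y by exact: open_nbhs_nbhs.
  by apply: filterS => y Oy; rewrite fg.
exact: cvg_trans (near_eq_cvg nO) cg.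
Qed.

Lemma continuous_at_add f g x : {for x, continuous f} -> {for x, continuous g} ->
  {for x, continuous (fun y => f y + g y)}.
Proof. by move=> cf cg; exact: (cvgD cf cg). Qed.

Lemma continuous_at_mul f g x : {for x, continuous f} -> {for x, continuous g} ->
  {for x, continuous (fun y => f y * g y)}.
Proof. by move=> cf cg; exact: (cvgM cf cg). Qed.

Lemma derive_eq_on O f g x v d : open O -> O x -> (forall y, O y -> f y = g y) ->
  is_derive x v g d -> is_derive x v f d.
Proof.
move=> oO Ox fg dg; have nO : \forall y \near nbhs x, O y by exact: open_nbhs_nbhs.
apply: (near_eq_is_derive _ dg).
by apply: filterS nO => y Oy; rewrite fg.
Qed.

Lemma is_derive_mul f g x v df dg : is_derive x v f df -> is_derive x v g dg ->
  is_derive x v (fun y => f y * g y) (f x * dg + g x * df).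
Proof.
move=> [f1 <-] [g1 <-]; split; first exact: (derivableM f1 g1).
exact: (deriveM f1 g1).
Qed.

Lemma is_derive_add f g x v df dg : is_derive x v f df -> is_derive x v g dg ->
  is_derive x v (fun y => f y + g y) (df + dg).
Proof.
move=> [f1 <-] [g1 <-]; split; first exact: (derivableD f1 g1).
exact: (deriveD f1 g1).
Qed.

Lemma C1_on_mul O f g : open O -> C1_on O f -> C1_on O g ->
  C1_on O (fun y => f y * g y).
Proof.
move=> oO cf cg.
have D j y : O y -> is_derive y (e j) (fun y => f y * g y)
    (f y * 'D_(e j) g y + g y * 'D_(e j) f y).
  move=> Oy; apply: is_derive_mul; apply: derivableP.
    by have [+ _] := cf j; exact.
  by have [+ _] := cg j; exact.
apply: C1_onP => // j x Ox; split; first by have [] := D j x Ox.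
apply: (continuous_eq_on oO Ox (g := fun y => f y * 'D_(e j) g y + g y * 'D_(e j) f y)).
  by move=> y /(D j)[].
have cDf := C1_on_continuousD oO cf Ox; have cDg := C1_on_continuousD oO cg Ox.
have c0f := C1_on_continuous oO cf Ox; have c0g := C1_on_continuous oO cg Ox.
apply: continuous_at_add; first exact: continuous_at_mul c0f (cDg j).
exact: continuous_at_mul c0g (cDf j).
Qed.

Lemma C1_on_subset O O' f : open O -> open O' -> O' `<=` O -> C1_on O f -> C1_on O' f.
Proof.
move=> oO oO' sub cf; apply: C1_onP => // j x /sub Ox; split.
  by have [+ _] := cf j; exact.
exact: (C1_on_continuousD oO cf).
Qed.

(** Coinduction: a class of continuous, partially derivable functions stable under partial
    derivatives consists of smooth functions. [iter_partial] applies the last index first, hence the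
    induction from the right end of the list. *)
Lemma smooth_coind (P : (V -> R) -> Prop) :
  (forall f, P f -> [/\ continuous f, forall j x, derivable f x (e j) &
     forall j, P ('D_(e j) f)]) ->
  forall f, P f -> smooth f.
Proof.
move=> HP f + l; elim/last_ind: l f => [|l j IH] f Pf.
  by have [? ? _] := HP f Pf.
have [_ _ /(_ j) PD] := HP f Pf.
have := IH _ PD; rewrite /iter_partial foldr_rcons.
by [].
Qed.

Lemma smooth_D j f : smooth f -> smooth ('D_(e j) f).
Proof. by move=> sf l; have := sf (rcons l j); rewrite /iter_partial foldr_rcons. Qed.

Lemma smooth_continuous f : smooth f -> continuous f.
Proof. by move=> /(_ [::])[]. Qed.

Lemma smooth_derivable f j x : smooth f -> derivable f x (e j).
Proof. by move=> /(_ [::])[_]; exact. Qed.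

Lemma smooth_is_derive f j x : smooth f -> is_derive x (e j) f ('D_(e j) f x).
Proof. by move=> sf; apply: derivableP; exact: smooth_derivable. Qed.

Lemma smooth_C1 f O : open O -> smooth f -> C1_on O f.
Proof.
move=> oO sf; apply: C1_onP => // j x _; split; first exact: smooth_derivable.
exact: (smooth_continuous (smooth_D j sf)).
Qed.

Lemma smooth_cst (c : R) : smooth (fun _ : V => c).
Proof.
apply: (@smooth_coind (fun f => exists c, f = fun=> c)); last by exists c.
move=> f [{}c ->]; split.
- exact: cst_continuous.
- by move=> j x; exact: derivable_cst.
- by move=> j; exists 0; apply: funext => x; have [_] := is_derive_cst c x (e j).
Qed.

(** The Leibniz rule sends a product to a sum of two products, so this is the class on which
    coinduction applies. *)
Inductive sum_of_products : (V -> R) -> Prop :=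
| SoP_mul f g : smooth f -> smooth g -> sum_of_products (fun x => f x * g x)
| SoP_add f g : sum_of_products f -> sum_of_products g ->
    sum_of_products (fun x => f x + g x).

Lemma smooth_SoP f : sum_of_products f -> smooth f.
Proof.
apply: smooth_coind => {}f; elim=> {f} [f g sf sg|f g _ [cf df Pf] _ [cg dg Pg]].
  split.
  - move=> x; apply: continuous_at_mul; exact: smooth_continuous.
  - move=> j x; have := is_derive_mul (smooth_is_derive j x sf) (smooth_is_derive j x sg).
    by case.
  - move=> j; have -> : 'D_(e j) (fun x => f x * g x) =
        (fun x => f x * 'D_(e j) g x + g x * 'D_(e j) f x).
      apply: funext => x.
      by have [] := is_derive_mul (smooth_is_derive j x sf) (smooth_is_derive j x sg).
    exact: (SoP_add (SoP_mul sf (smooth_D j sg)) (SoP_mul sg (smooth_D j sf))).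
have D j x := is_derive_add (derivableP (df j x)) (derivableP (dg j x)).
split.
- by move=> x; apply: continuous_at_add; [exact: cf|exact: cg].
- by move=> j x; have [] := D j x.
- move=> j; have -> : 'D_(e j) (fun x => f x + g x) =
      (fun x => 'D_(e j) f x + 'D_(e j) g x).
    by apply: funext => x; have [] := D j x.
  exact: SoP_add.
Qed.

Lemma smooth_mul f g : smooth f -> smooth g -> smooth (fun x => f x * g x).
Proof. by move=> sf sg; apply: smooth_SoP; exact: SoP_mul. Qed.

Lemma smooth_prod (I : Type) (r : seq I) (F : I -> V -> R) :
  (forall i, smooth (F i)) -> smooth (fun x => \prod_(i <- r) F i x).
Proof.
move=> sF; elim: r => [|i r IH].
  have -> : (fun x => \prod_(i <- [::]) F i x) = (fun=> 1).
    by apply: funext => x; rewrite big_nil.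
  exact: smooth_cst.
have -> : (fun x => \prod_(i <- i :: r) F i x) =
    (fun x => F i x * \prod_(i <- r) F i x).
  by apply: funext => x; rewrite big_cons.
exact: (smooth_mul (sF i) IH).
Qed.

Definition affine_coord (s : R) (i : 'I_n) (d : R) : V -> R := fun x => s * x 0 i + d.

Lemma affine_coord_continuous s i d : continuous (affine_coord s i d).
Proof.
move=> x; apply: (@continuous_at_add (fun x => s * x 0 i) (fun=> d)); last exact: cst_continuous.
apply: (@continuous_at_mul (fun=> s) (fun x => x 0 i)); first exact: cst_continuous.
exact: coord_continuous.
Qed.

(* The difference quotient of [phi \o affine_coord s i d] along [v] at [x] is
   literally that of [phi] along the real [s * v_i]. *)
Lemma is_derive_comp_affine (phi : R -> R) s i d x v (dphi : R) :
  is_derive (affine_coord s i d x) (1 : R) phi dphi ->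
  is_derive x v (phi \o affine_coord s i d) (s * v 0 i * dphi).
Proof.
set t := affine_coord s i d x => dp.
have dfp : differentiable phi t by apply/derivable1_diffP; case: dp.
have pd : is_derive t (s * v 0 i : R) phi (s * v 0 i * dphi).
  split; first exact: diff_derivable.
  rewrite deriveE // -[s * v 0 i]mulr1 -[_ * 1]/(_ *: (1 : R)) linearZ /= -deriveE //.
  by have [_ ->] := dp; rewrite /GRing.scale /= mulr1.
have E : (fun h : R => h^-1 *: (((phi \o affine_coord s i d) \o shift x) (h *: v) - (phi \o affine_coord s i d) x))
   = (fun h : R => h^-1 *: ((phi \o shift t) (h *: (s * v 0 i : R)) - phi t)).
  apply: funext => h /=; congr (_ *: (phi _ - _)).
  by rewrite /t /affine_coord !mxE /GRing.scale /=; ring.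
case: pd => p1 p2; split; first by rewrite /derivable E.
by rewrite /derive E.
Qed.

Lemma smooth_affine_coord s i d : smooth (affine_coord s i d).
Proof.
apply: (@smooth_coind (fun f => f = affine_coord s i d \/ exists c, f = fun=> c)); last by left.
move=> f [->|[c ->]].
  have D j x : is_derive x (e j) (affine_coord s i d) (s * e j 0 i * 1).
    by apply: (@is_derive_comp_affine id); exact: is_derive_id.
  split; first exact: affine_coord_continuous.
    by move=> j x; have [] := D j x.
  move=> j; right; exists (s * e j 0 i); apply: funext => x.
  by have [_ ->] := D j x; rewrite mulr1.
split.
- exact: cst_continuous.
- by move=> j x; exact: derivable_cst.
- by move=> j; right; exists 0; apply: funext => x; have [_] := is_derive_cst c x (e j).
Qed.

End Smooth.

(** * Smooth bump functions built from [exp(-1/t)] *)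

Section Bump.
Variable R : realType.
Implicit Types (p : {poly R}) (t : R).

Definition flat p t : R := if 0 < t then p.[t^-1] * expR (- t^-1) else 0.

Lemma expr_le_fact_expR (m : nat) (y : R) : 0 <= y -> y ^+ m <= m`!%:R * expR y.
Proof.
move=> y0; case: m => [|m].
  by rewrite expr0 mul1r; apply: le_trans (expR_ge1Dxn 0 y0); rewrite lerDl divr_ge0.
rewrite mulrC -ler_pdivrMr ?ltr0n ?fact_gt0 //.
by apply: le_trans (expR_ge1Dxn m y0); rewrite lerDr.
Qed.

(** The exponent [m] is general so that the factor ['X] of the Horner step is absorbed into
    [m + 1]. *)
Lemma poly_expR_bounded p (m : nat) :
  exists2 C : R, 0 <= C & forall y, 0 <= y -> y ^+ m * `|p.[y]| * expR (- y) <= C.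
Proof.
elim/poly_ind: p m => [|p c IH] m.
  by exists 0 => // y y0; rewrite horner0 normr0 mulr0 mul0r.
have [C C0 HC] := IH m.+1; exists (C + `|c| * m`!%:R) => [|y y0].
  by rewrite addr_ge0 // mulr_ge0.
rewrite !hornerE; apply: (@le_trans _ _ (y ^+ m * (`|p.[y]| * y + `|c|) * expR (- y))).
  rewrite ler_wpM2r ?expR_ge0 // ler_wpM2l ?exprn_ge0 //.
  by apply: le_trans (ler_normD _ _) _; rewrite normrM (ger0_norm y0).
rewrite mulrDr mulrDl; apply: lerD.
  by apply: le_trans (HC y y0); rewrite exprSr mulrA [y ^+ m * _ * y]mulrAC.
rewrite [_ * `|c|]mulrC -mulrA ler_wpM2l //.
by rewrite expRN ler_pdivrMr ?expR_gt0 //; exact: expr_le_fact_expR.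
Qed.

Lemma flat_small p : exists2 C : R, 0 <= C & forall t, `|flat p t| <= C * `|t|.
Proof.
have [C C0 HC] := poly_expR_bounded p 1; exists C => // t; rewrite /flat.
case: ifP => t0; last by rewrite normr0 mulr_ge0.
rewrite (gtr0_norm t0) normrM (ger0_norm (expR_ge0 _)) -ler_pdivrMr //.
have := HC t^-1; rewrite invr_ge0 => /(_ (ltW t0)); rewrite expr1.
by apply: le_trans; rewrite mulrC mulrA.
Qed.

Lemma is_derive_flat p t :
  is_derive t (1 : R) (flat p) (flat ('X^2 * (p - p^`())) t).
Proof.
have [t0|t0|->] := ltgtP t 0.
- have -> : flat ('X^2 * (p - p^`())) t = 0 by rewrite /flat ltNge (ltW t0).
  apply: (near_eq_is_derive _ (is_derive_cst (0 : R) t (1 : R))).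
  have : \forall y \near nbhs t, y < 0 by apply: open_nbhs_nbhs; split; [exact: open_lt|].
  by apply: filterS => y y0; rewrite /flat ltNge (ltW y0).
- have -> : flat ('X^2 * (p - p^`())) t = ('X^2 * (p - p^`())).[t^-1] * expR (- t^-1).
    by rewrite /flat t0.
  have dV : is_derive t (1 : R) (fun y : R => y^-1) (- t ^- 2).
    have := @is_deriveV R id t 1 1 (lt0r_neq0 t0) (is_derive_id _ _).
    by rewrite [_ *: _]mulr1.
  have dp : is_derive t (1 : R) (fun y : R => p.[y^-1]) (p^`().[t^-1] * - t ^- 2).
    exact: (@is_derive1_comp _ (horner p) (fun y : R => y^-1) _ _ _ (is_derive_poly _ _) dV).
  have de : is_derive t (1 : R) (fun y : R => expR (- y^-1)) (expR (- t^-1) * - - t ^- 2).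
    exact: (@is_derive1_comp _ expR (fun y : R => - y^-1) _ _ _ (is_derive_expR _) (is_deriveN dV)).
  apply: (near_eq_is_derive _ (is_derive_eq (is_deriveM dp de) _)).
    have : \forall y \near nbhs t, 0 < y by apply: open_nbhs_nbhs; split; [exact: open_gt|].
    by apply: filterS => y y0; rewrite /flat y0.
  by rewrite hornerM hornerXn hornerD hornerN -!exprVn /GRing.scale /=; ring.
have flat0 q : flat q 0 = 0 by rewrite /flat ltxx.
rewrite flat0.
suff fl : (fun h : R => h^-1 *: ((flat p \o shift (0:R)) (h *: (1:R)) - flat p 0)) @ (0 : R)^' --> (0:R).
  by split; [exact: (cvgP _ fl) | exact: cvg_lim fl].
(* At 0 the difference quotient of [flat p] is [flat ('X * p)], of order [|h|]. *)
have [C C0 HC] := flat_small ('X * p).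
apply/cvgrPdist_le => eps eps0; near=> h.
have h0 : h != 0 by near: h; exact: nbhs_dnbhs_neq.
have hC : `|h| < eps / (C + 1) by near: h; apply: dnbhs0_lt; rewrite divr_gt0 // ltr_wpDl.
rewrite /= addr0 flat0 subr0 [h *: 1]mulr1 sub0r normrN.
have -> : h^-1 *: flat p h = flat ('X * p) h.
  rewrite /GRing.scale /= /flat; case: ifP => _; last by rewrite mulr0.
  by rewrite hornerM hornerX mulrA.
apply: le_trans (HC h) _; rewrite mulrC.
apply: le_trans (_ : eps / (C + 1) * C <= _); first by rewrite ler_wpM2r // ltW.
by rewrite mulrAC ler_pdivrMr ?ltr_wpDl // ler_pM2l // lerDl.
Unshelve. all: by end_near. Qed.

Lemma flat_continuous p : continuous (flat p).
Proof.
move=> t; apply: differentiable_continuous; apply/derivable1_diffP.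
by have [] := is_derive_flat p t.
Qed.

Lemma flatZ (c : R) p t : flat (c *: p) t = c * flat p t.
Proof. by rewrite /flat; case: ifP => _; rewrite ?mulr0 // hornerZ mulrA. Qed.

Lemma flat1_gt0 t : 0 < t -> 0 < flat 1 t.
Proof. by move=> t0; rewrite /flat t0 hornerC mul1r expR_gt0. Qed.

Lemma flat1_ge0 t : 0 <= flat 1 t.
Proof. by rewrite /flat; case: ifP => // _; rewrite hornerC mul1r expR_ge0. Qed.

Lemma flat1_le1 t : flat 1 t <= 1.
Proof.
rewrite /flat; case: ifP => // t0; rewrite hornerC mul1r expR_le1 oppr_le0 invr_ge0.
exact: ltW.
Qed.

Lemma flat_le0 p t : t <= 0 -> flat p t = 0.
Proof. by rewrite /flat ltNge => ->. Qed.

(** The value is [exp(-1/(k t))] for positive [k]; the index is shifted by one so that [k] becomes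
    invertible. *)
Lemma flat1_scale_cvg t : 0 < t -> flat 1 (k%:R * t) @[k --> \oo] --> (1 : R).
Proof.
move=> t0.
have inv0 : - (k.+1%:R^-1 * t^-1) @[k --> \oo] --> (- (0 * t^-1) : R).
  by apply: cvgN; apply: cvgM; [exact: cvg_harmonic | exact: cvg_cst].
have : expR (- (k.+1%:R^-1 * t^-1)) @[k --> \oo] --> expR (- (0 * t^-1) : R).
  exact: (continuous_cvg _ (@continuous_expR R _) inv0).
rewrite mul0r oppr0 expR0 => h; rewrite -(cvg_shiftS (fun k : nat => flat 1 (k%:R * t))) /=.
have <- : (fun k : nat => expR (- (k.+1%:R^-1 * t^-1))) = (fun k : nat => flat 1 (k.+1%:R * t)).
  by apply: funext => k; rewrite /flat mulr_gt0 // hornerC mul1r invfM.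
exact: h.
Qed.

Variable n : nat.
Notation V := 'rV[R]_n.

Lemma smooth_flat p s i d : smooth (flat p \o @affine_coord R n s i d).
Proof.
apply: (@smooth_coind _ _ (fun f => exists q, f = flat q \o affine_coord s i d)); last by exists p.
move=> f [q ->].
have D j x := @is_derive_comp_affine _ _ (flat q) s i d x (evec R j) _ (is_derive_flat q _).
split.
- by move=> x; apply: continuous_comp; [exact: affine_coord_continuous|exact: flat_continuous].
- by move=> j x; have [] := D j x.
- move=> j; exists ((s * evec R j 0 i) *: ('X^2 * (q - q^`()))); apply: funext => x.
  by have [_ ->] := D j x; rewrite /= flatZ.
Qed.

Definition box (a b : V) : set V := [set x | forall i, a 0 i < x 0 i < b 0 i].

(** Sending [m] to infinity makes every factor tend to 1 inside the box, while outside some factor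
    is 0: these smooth functions tend to the indicator of the box. *)
Definition boxbump (m : R) (a b : V) : V -> R := fun x =>
  \prod_i ((flat 1 \o affine_coord m i (- (m * a 0 i))) x *
           (flat 1 \o affine_coord (- m) i (m * b 0 i)) x).

Lemma boxbumpE m a b x : boxbump m a b x =
  \prod_i (flat 1 (m * (x 0 i - a 0 i)) * flat 1 (m * (b 0 i - x 0 i))).
Proof.
by apply: eq_bigr => i _; rewrite /affine_coord /=; congr (flat 1 _ * flat 1 _); ring.
Qed.

Lemma smooth_boxbump m a b : smooth (boxbump m a b).
Proof. by apply: smooth_prod => i; apply: smooth_mul; exact: smooth_flat. Qed.

Lemma boxbump_ge0_le1 m a b x : 0 <= boxbump m a b x <= 1.
Proof.
rewrite boxbumpE prodr_ge0 /=; last by move=> i _; rewrite mulr_ge0 ?flat1_ge0.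
by apply: prodr_ile1 => i _; rewrite mulr_ge0 ?flat1_ge0 //= mulr_ile1 ?flat1_ge0 ?flat1_le1.
Qed.

Lemma boxbump_gt0 m a b x : 0 < m -> box a b x -> 0 < boxbump m a b x.
Proof.
move=> m0 abx; rewrite boxbumpE; apply: prodr_gt0 => i _; have /andP[ai bi] := abx i.
by apply: mulr_gt0; apply: flat1_gt0; rewrite mulr_gt0 // subr_gt0.
Qed.

Lemma boxbump_out m a b x : 0 <= m -> ~ box a b x -> boxbump m a b x = 0.
Proof.
move=> m0 /existsNP[i] /negP; rewrite negb_and -!leNgt => abi; rewrite boxbumpE.
apply/eqP/prodf_eq0; exists i => //; case/orP: abi => abi.
  by rewrite flat_le0 ?mul0r // mulr_ge0_le0 // subr_le0.
by rewrite [X in _ * X]flat_le0 ?mulr0 // mulr_ge0_le0 // subr_le0.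
Qed.

Lemma boxbump_cvg a b x :
  boxbump k%:R a b x @[k --> \oo] --> (\1_(box a b) x : R).
Proof.
rewrite indicE; have [abx|abx] := pselect (box a b x).
  rewrite mem_set //=.
  have -> : (1%:R : R) = \prod_(i < n) (1 * 1) by rewrite mul1r big1.
  under eq_fun do rewrite boxbumpE.
  apply: (@cvg_big _ _ _ _ _ _ _ _ _ (fun i (k : nat) => flat 1 (k%:R * (x 0 i - a 0 i)) * flat 1 (k%:R * (b 0 i - x 0 i))) (fun=> 1 * 1)) => [z|i _]; first exact: mul_continuous.
  have /andP[ai bi] := abx i.
  by apply: cvgM; apply: flat1_scale_cvg; rewrite subr_gt0.
rewrite memNset //=; under eq_fun do rewrite boxbump_out //.
exact: cvg_cst.
Qed.

End Bump.

(** * Bernstein approximation and the boundary identity for C^1 forms *)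

Section Bernstein.
Variable R : realFieldType.
Implicit Types (F G : nat -> R) (t : R).

(* [bern N F t] is [\sum_p 'C(N, p) * t ^+ p * (1 - t) ^+ (N - p) * F p],
   in the form given by Pascal's rule. *)
Fixpoint bern N F t : R :=
  if N is N'.+1 then (1 - t) * bern N' F t + t * bern N' (fun p => F p.+1) t
  else F 0%N.

Lemma eq_bern N F G t : (forall p, (p <= N)%N -> F p = G p) -> bern N F t = bern N G t.
Proof.
elim: N F G => [|N IH] F G FG /=; first exact: FG.
by congr (_ * _ + _ * _); apply: IH => p pN; apply: FG; rewrite // ltnW.
Qed.

Lemma bern_const N c t : bern N (fun=> c) t = c.
Proof. by elim: N => //= N ->; ring. Qed.

Lemma bernD N F G t : bern N (fun p => F p + G p) t = bern N F t + bern N G t.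
Proof. by elim: N F G => //= N IH F G; rewrite !IH; ring. Qed.

Lemma bernZ N c F t : bern N (fun p => c * F p) t = c * bern N F t.
Proof. by elim: N F => //= N IH F; rewrite !IH; ring. Qed.

Lemma bern_le N F G t : 0 <= t <= 1 -> (forall p, (p <= N)%N -> F p <= G p) ->
  bern N F t <= bern N G t.
Proof.
move=> /andP[t0 t1]; elim: N F G => [|N IH] F G FG /=; first exact: FG.
by apply: lerD; apply: ler_wpM2l; rewrite ?subr_ge0 //; apply: IH => p pN;
  apply: FG; rewrite // ltnW.
Qed.

Lemma bern_abs N F t M : 0 <= t <= 1 -> (forall p, (p <= N)%N -> `|F p| <= M) ->
  `|bern N F t| <= M.
Proof.
move=> t01 FM; rewrite ler_norml -{1}(bern_const N (- M) t) -[X in _ && (_ <= X)](bern_const N M t).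
by apply/andP; split; apply: bern_le => // p /FM; rewrite ler_norml => /andP[].
Qed.

(** Second moment of the binomial law about a centre [s]. The centre is arbitrary because Pascal's
    rule shifts it by 1. *)
Lemma bern_variance N t s :
  bern N (fun p => (p%:R - s) ^+ 2) t = (N%:R * t - s) ^+ 2 + N%:R * t * (1 - t).
Proof.
elim: N s => [|N IH] s /=; first by rewrite !mul0r addr0.
have -> : (fun p : nat => (p.+1%:R - s) ^+ 2) = (fun p : nat => (p%:R - (s - 1)) ^+ 2) :> (nat -> R).
  by apply: funext => p; rewrite -natr1; ring.
by rewrite !IH -natr1; ring.
Qed.

(** The average is positive and fixes constants, so the quadratic bound may be averaged; the
    variance [N t (1 - t)] is at most [N]. *)
Lemma bern_dist N F t L e K : 0 <= t <= 1 -> 0 <= K ->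
  (forall p, (p <= N)%N -> `|F p - L| <= e + K * ((p%:R - N%:R * t) ^+ 2 + 1)) ->
  `|bern N F t - L| <= e + K * N.+1%:R.
Proof.
move=> t01 K0 FL.
have -> : bern N F t - L = bern N (fun p => F p - L) t.
  by rewrite bernD bern_const.
have bound : bern N (fun p => e + K * ((p%:R - N%:R * t) ^+ 2 + 1)) t <= e + K * N.+1%:R.
  rewrite bernD bernZ bernD !bern_const bern_variance subrr expr0n /= add0r lerD2l.
  rewrite ler_wpM2l // -natr1 lerD2r; have [t0 t1] := andP t01.
  rewrite -mulrA ler_piMr // ?ler0n //.
  by rewrite mulr_ile1 ?subr_ge0 // gerBl.
rewrite ler_norml; apply/andP; split; last first.
  by apply: le_trans bound; apply: bern_le => // p /FL; rewrite ler_norml => /andP[].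
rewrite lerNl; apply: le_trans bound; rewrite -mulN1r -bernZ.
apply: bern_le => // p /FL; rewrite mulN1r ler_norml => /andP[+ _].
by rewrite lerNl.
Qed.

End Bernstein.

(** * Measurability, compact cubes and boundedness *)

Section BorelRn.
Variables (R : realType) (n : nat).
Notation V := 'rV[R]_n.

Lemma open_measurable_Rn (A : set V) : open A -> measurable (A : set (Rn_borel R n)).
Proof. by move=> oA; apply: sub_sigma_algebra. Qed.

Lemma continuous_measurable_Rn (f : V -> R) : continuous f ->
  measurable_fun (setT : set (Rn_borel R n)) (f : Rn_borel R n -> R).
Proof.
move=> /continuousP cf mD; apply: (measurability _ (measurable_realfun.RGenOpens.measurableE R)) => //.
move=> _ [_ [a [b ->] <-]]; rewrite setTI; apply: open_measurable_Rn.
exact/cf/interval_open.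
Qed.

Lemma bounded_on_compact (K : set V) (f : V -> R) : compact K ->
  (forall x, K x -> {for x, continuous f}) ->
  exists2 M, 0 <= M & forall x, K x -> `|f x| <= M.
Proof.
move=> cK cf.
have : compact (f @` K).
  apply: continuous_compact => //; apply: continuous_in_subspaceT => x.
  by rewrite inE; exact: cf.
move=> /compact_bounded[M [_ HM]]; exists (`|M| + 1) => [|x Kx]; first by rewrite addr_ge0.
by apply: (HM (`|M| + 1)); [rewrite (le_lt_trans (ler_norm M)) // ltrDl | exists x].
Qed.

(** The closed counterpart of the sup-norm balls. Cutoffs vanish off a cube of radius [r] contained
    in a ball of radius [r' > r], on which the C^1 functions live. *)
Definition cube (c : V) (r : R) : set V := [set x | forall i, `|c 0 i - x 0 i| <= r].

Lemma cube_compact c r : compact (cube c r).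
Proof.
have -> : cube c r = [set x | forall i, `[c 0 i - r, c 0 i + r]%classic (x ord0 i)].
  apply/seteqP; split => x /= cx i; have := cx i;
    by rewrite /= in_itv /= ler_distlC.
exact: (rV_compact (fun i => @segment_compact _ _ _)).
Qed.

Lemma cube_closed c r : closed (cube c r).
Proof. by apply: compact_closed; [exact: norm_hausdorff | exact: cube_compact]. Qed.

End BorelRn.

Section BernsteinFields.
Variables (R : realType) (n : nat).
Notation V := 'rV[R]_n.
Notation e := (evec R).

(** Differentiating the weights gives [N] times the average, in degree [N - 1], of the increments of
    the coefficients. For [N = 0] that term vanishes through its factor. *)
Lemma is_derive_bern N (F : nat -> V -> R) (dF : nat -> R) (tau : V -> R) dtau x v :
  (forall p, is_derive x v (F p) (dF p)) -> is_derive x v tau dtau ->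
  is_derive x v (fun y => bern N (F^~ y) (tau y))
    (bern N dF (tau x) + dtau * (N%:R * bern N.-1 (fun p => F p.+1 x - F p x) (tau x))).
Proof.
move=> + dt; elim: N F dF => [|N IH] F dF FD /=.
  by rewrite mul0r mulr0 addr0; exact: FD.
have d1t : is_derive x v (fun y => 1 - tau y) (0 - dtau).
  by apply: (is_derive_add (is_derive_cst (1:R) x v)); exact: is_deriveN.
have := is_derive_add (is_derive_mul d1t (IH F dF FD))
  (is_derive_mul dt (IH (fun p => F p.+1) (fun p => dF p.+1) (fun p => FD p.+1))).
move=> /is_derive_eq; apply.
case: N {IH} => [|N]; first by rewrite /=; ring.
rewrite [N.+1.-1]/= -[in RHS]natr1.
have -> : bern N.+1 (fun p => F p.+1 x - F p x) (tau x) =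
    bern N.+1 (fun p => F p.+1 x) (tau x) - bern N.+1 (F^~ x) (tau x).
  rewrite -mulN1r -bernZ -bernD; congr bern; apply: funext => p; ring.
have -> : bern N.+1 (F^~ x) (tau x) = (1 - tau x) * bern N (F^~ x) (tau x) +
  tau x * bern N (fun p => F p.+1 x) (tau x) by [].
have -> : bern N.+1 (fun p => F p.+1 x) (tau x) = (1 - tau x) * bern N (fun p => F p.+1 x) (tau x) +
  tau x * bern N (fun p => F p.+2 x) (tau x) by [].
have D (G H : nat -> R) : bern N (fun p => G p - H p) (tau x) = bern N G (tau x) - bern N H (tau x).
  rewrite -mulN1r -bernZ -bernD; congr bern; apply: funext => p; ring.
rewrite !D; ring.
Qed.

(** The sampling points need only stay as close to [x0] as the binomial deviation divided by
    [N + 1]. This covers both grid points in degree [N + 1] and mean value points in degree [N]. *)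
Lemma bern_cvg (k : R -> R) (x0 t D a b M : R) (d : nat -> nat) (s : nat -> nat -> R) :
  0 <= t <= 1 -> 0 <= D -> a <= x0 <= b -> {for x0, continuous k} ->
  (forall y, a <= y <= b -> `|k y| <= M) ->
  (forall N, (d N <= N.+1)%N) ->
  (forall N p, (p <= d N)%N -> a <= s N p <= b) ->
  (forall N p, (p <= d N)%N ->
     (s N p - x0) ^+ 2 <= D / N.+1%:R ^+ 2 * ((p%:R - (d N)%:R * t) ^+ 2 + 1)) ->
  bern (d N) (fun p => k (s N p)) t @[N --> \oo] --> k x0.
Proof.
move=> t01 D0 x0ab ck kM dN sab sD.
have M0 : 0 <= M by apply: le_trans (kM x0 x0ab).
apply/cvgrPdist_le => eps eps0.
have e2 : 0 < eps / 2 by rewrite divr_gt0.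
have [de /= de0 kde] : exists2 de, 0 < de & forall y, `|x0 - y| < de -> `|k x0 - k y| < eps / 2.
  have /cvgrPdist_lt/(_ _ e2)/nbhs_ballP[de /= de0 H] : k y @[y --> x0] --> k x0 by exact: ck.
  by exists de.
(* Within [de] of [x0] continuity gives [eps / 2]; farther away the oscillation [2 * M] is at most
   [C * (y - x0) ^+ 2]. *)
pose C := 2 * M / de ^+ 2.
have C0 : 0 <= C by apply: divr_ge0; [exact: mulr_ge0 | exact: sqr_ge0].
have osc y : a <= y <= b -> `|k y - k x0| <= eps / 2 + C * (y - x0) ^+ 2.
  move=> yab; have [lt|ge] := ltP `|x0 - y| de.
    rewrite distrC; apply: le_trans (ltW (kde y lt)) _.
    by rewrite lerDl mulr_ge0 // sqr_ge0.
  apply: le_trans (ler_normB _ _) _; apply: le_trans (lerD (kM _ yab) (kM _ x0ab)) _.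
  apply: ler_wpDl; first exact: ltW.
  rewrite /C mulrAC ler_pdivlMr ?exprn_gt0 //.
  have -> : M + M = 2 * M by ring.
  apply: ler_wpM2l; first exact: mulr_ge0.
  rewrite -[leRHS]real_normK ?num_real // ler_sqr ?nnegrE ?(ltW de0) //.
  by rewrite distrC.
near=> N; rewrite distrC.
have N0 : 0 < N.+1%:R :> R by [].
have K0 : 0 <= C * (D / N.+1%:R ^+ 2) by rewrite mulr_ge0 // divr_ge0 // exprn_ge0.
apply: le_trans (bern_dist (e := eps / 2) t01 K0 _) _ => [p pd|].
  apply: le_trans (osc _ (sab N p pd)) _; rewrite lerD2l -[leRHS]mulrA.
  by apply: ler_wpM2l => //; exact: sD.
rewrite [leRHS](splitr eps) lerD2l.
have dN2 : ((d N).+1%:R : R) <= 2 * N.+1%:R.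
  rewrite -natrM ler_nat; apply: leq_trans (_ : (N.+2 <= _)%N); first by rewrite ltnS.
  by rewrite mul2n -addnn addSn addnS !ltnS leq_addr.
apply: le_trans (ler_wpM2l K0 dN2) _.
(* The variance is of order [N] and is divided by [N^2], which leaves an error of order [1 / N]. *)
have -> : C * (D / N.+1%:R ^+ 2) * (2 * N.+1%:R) = C * D * 2 / N.+1%:R by field; rewrite addr_eq0; lra.
rewrite ler_pdivrMr // [leRHS]mulrC -ler_pdivrMr //.
have NN : (N%:R : R) <= N.+1%:R by rewrite ler_nat.
apply: le_trans NN.
by near: N; exact: nbhs_infty_ger.
Unshelve. all: by end_near. Qed.

Variables (c0 : V) (r r' : R).
Hypotheses (r0 : 0 < r) (rr' : r < r').
Let B : set V := ball c0 r'.
Let Q : set V := cube c0 r.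
Let r'0 : 0 < r'. Proof. exact: lt_trans rr'. Qed.
Let oB : open B. Proof. exact: ball_open. Qed.

Lemma cube_ball : Q `<=` B.
Proof. by move=> x Qx; apply/ballP => // i; exact: le_lt_trans (Qx i) rr'. Qed.

(** Freezes one coordinate: the functions [h \o upd i0 s] are the coefficients of the Bernstein
    polynomial of [h] in the coordinate [i0]. *)
Definition upd (i0 : 'I_n) (s : R) (x : V) : V := \row_j if j == i0 then s else x 0 j.

Lemma upd_ball i0 s x : `|c0 0 i0 - s| < r' -> B x -> B (upd i0 s x).
Proof.
move=> sr /ballP-/(_ r'0) Bx; apply/ballP => // i; rewrite mxE.
by case: eqP => [->|].
Qed.

Lemma upd_cube i0 s x : `|c0 0 i0 - s| <= r -> Q x -> Q (upd i0 s x).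
Proof. by move=> sr Qx i; rewrite mxE; case: eqP => [->|]. Qed.

Lemma upd_continuous i0 s : continuous (upd i0 s).
Proof.
move=> x; suff : upd i0 s y @[y --> x] --> upd i0 s x by [].
move=> A /nbhs_ballP[d /= d0 dA]; apply/nbhs_ballP; exists d => //= y xy.
apply: dA; apply/ballP => // i; rewrite !mxE; case: eqP => _.
  by rewrite subrr normr0.
by move: i; apply/ballP.
Qed.

Lemma upd_id i0 (x : V) : upd i0 (x 0 i0) x = x.
Proof. by apply/rowP => i; rewrite mxE; case: eqP => [->|]. Qed.

Lemma upd_add i0 s d (x : V) : upd i0 (d + s) x = d *: e i0 + upd i0 s x.
Proof.
apply/rowP => i; rewrite !mxE eqxx /=; case: eqP => _; first by rewrite mulr1.
by rewrite mulr0 add0r.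
Qed.

Lemma is_derive_upd (h : V -> R) i0 s j x : C1_on B h -> `|c0 0 i0 - s| < r' -> B x ->
  is_derive x (e j) (h \o upd i0 s) (if j == i0 then 0 else 'D_(e j) h (upd i0 s x)).
Proof.
move=> ch sr Bx; have [->|ji] := eqVneq j i0.
  have E : (fun t : R => t^-1 *: (((h \o upd i0 s) \o shift x) (t *: e i0) - (h \o upd i0 s) x))
    = (fun t : R => t^-1 *: (((cst (0:R)) \o shift x) (t *: e i0) - (cst (0:R)) x)).
    apply: funext => t /=; congr (_ *: _); rewrite subrr.
    have -> : upd i0 s (t *: e i0 + x) = upd i0 s x; last by rewrite subrr.
    by apply/rowP => i; rewrite !mxE; case: eqP => // _; rewrite andbF mulr0 add0r.
  have [p1 p2] := is_derive_cst (0:R) x (e i0).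
  by split; [rewrite /derivable E | rewrite /derive E].
have p1 : derivable h (upd i0 s x) (e j).
  by have [+ _] := ch j; apply; exact: upd_ball.
have E : (fun t : R => t^-1 *: (((h \o upd i0 s) \o shift x) (t *: e j) - (h \o upd i0 s) x))
    = (fun t : R => t^-1 *: ((h \o shift (upd i0 s x)) (t *: e j) - h (upd i0 s x))).
  apply: funext => t /=; congr (_ *: (h _ - _)).
  apply/rowP => i; rewrite !mxE; case: eqP => [->|//] /=.
  by rewrite eq_sym (negbTE ji) mulr0 add0r.
by split; [rewrite /derivable E | rewrite /derive E].
Qed.

Lemma C1_on_upd (h : V -> R) i0 s : C1_on B h -> `|c0 0 i0 - s| < r' ->
  C1_on B (h \o upd i0 s).
Proof.
move=> ch sr; apply: C1_onP => // j x Bx; have D := is_derive_upd j ch sr; split.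
  by have [] := D x Bx.
apply: (continuous_eq_on oB Bx (g := fun y => if j == i0 then 0 else 'D_(e j) h (upd i0 s y))).
  by move=> y /D[].
case: (j == i0); first exact: cst_continuous.
apply: (@continuous_comp _ _ _ (upd i0 s) ('D_(e j) h)); first exact: upd_continuous.
exact: (C1_on_continuousD oB ch (upd_ball sr Bx)).
Qed.

End BernsteinFields.

Lemma and3_third (A B C : Prop) : [/\ A, B & C] -> C.
Proof. by case. Qed.

(** * Extension of a divergence identity from smooth to C^1 functions *)

Section Density.
Variables (R : realType) (n : nat).
Notation V := 'rV[R]_n.
Notation e := (evec R).

Lemma integrable_bounded_mul (nu : {measure set (Rn_borel R n) -> \bar R})
    (f t : V -> R) (M : R) : continuous f -> (forall x, `|f x| <= M) ->
  nu.-integrable setT (fun x => (t x)%:E) ->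
  nu.-integrable setT (fun x => (f x * t x)%:E).
Proof.
move=> /continuous_measurable_Rn mf fM it.
have bf : [bounded (f : Rn_borel R n -> R) x | x in (setT : set (Rn_borel R n))].
  exists M; split; first exact: num_real.
  by move=> N MN x _; apply: le_trans (fM x) (ltW MN).
exact: (integrableMr measurableT mf bf it).
Qed.

Variables (mu mu' : {measure set (Rn_borel R n) -> \bar R}).
Variables (t' : V -> R) (c : 'I_n -> V -> R).
Hypothesis it' : mu'.-integrable setT (fun x => (t' x)%:E).
Hypothesis ic : forall l, mu.-integrable setT (fun x => (c l x)%:E).
Variables (c0 : V) (r r' : R).
Hypotheses (r0 : 0 < r) (rr' : r < r').
Let B : set V := ball c0 r'.
Let Q : set V := cube c0 r.
Let r'0 : 0 < r'. Proof. exact: lt_trans rr'. Qed.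
Let oB : open B. Proof. exact: ball_open. Qed.
Let oQ : open (~` Q). Proof. by rewrite openC; exact: cube_closed. Qed.
Let QB : Q `<=` B. Proof. exact: cube_ball. Qed.

(** The boundary identity read on one coefficient, so that the approximation concerns scalar
    functions only. *)
Definition div_identity (f : V -> R) : Prop :=
  (\int[mu']_x (f x * t' x)%:E = \int[mu]_x (\sum_l 'D_(e l) f x * c l x)%:E)%E.

Definition C1_supp (f : V -> R) := C1_on setT f /\ forall x, ~ Q x -> f x = 0.

Lemma C1_supp_continuous f : C1_supp f -> continuous f.
Proof. by move=> [cf _] x; exact: (C1_on_continuous openT cf). Qed.

Lemma C1_supp_continuousD f l : C1_supp f -> continuous ('D_(e l) f).
Proof. by move=> [cf _] x; exact: (C1_on_continuousD openT cf). Qed.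

Lemma C1_supp_is_derive f l x : C1_supp f -> is_derive x (e l) f ('D_(e l) f x).
Proof. by move=> [cf _]; apply: derivableP; have [+ _] := cf l; exact. Qed.

Lemma C1_supp_D0 f l x : C1_supp f -> ~ Q x -> 'D_(e l) f x = 0.
Proof.
move=> [_ f0] Qx.
by have [] := derive_eq_on oQ Qx f0 (is_derive_cst (0 : R) x (e l)).
Qed.

Lemma vanishing_bounded (f : V -> R) : continuous f -> (forall x, ~ Q x -> f x = 0) ->
  exists M, forall x, `|f x| <= M.
Proof.
move=> cf f0; have [M M0 HM] := bounded_on_compact (@cube_compact _ _ c0 r) (fun x _ => cf x).
exists M => x; have [/HM//|/f0 ->] := pselect (Q x).
by rewrite normr0.
Qed.

Lemma C1_supp_integrable f : C1_supp f ->
  mu'.-integrable setT (fun x => (f x * t' x)%:E).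
Proof.
move=> sf; have cf := C1_supp_continuous sf.
have [M HM] := vanishing_bounded cf sf.2.
exact: integrable_bounded_mul HM it'.
Qed.

Lemma C1_supp_integrableD f : C1_supp f ->
  mu.-integrable setT (fun x => (\sum_l 'D_(e l) f x * c l x)%:E).
Proof.
move=> sf.
rewrite (_ : (fun x => _) = (fun x => (\sum_l ('D_(e l) f x * c l x)%:E)%E)); last first.
  by apply: funext => x; rewrite sumEFin.
apply: integrable_sum => // l _.
have [M HM] := vanishing_bounded (C1_supp_continuousD (l := l) sf) (fun x => C1_supp_D0 l sf).
exact: integrable_bounded_mul (C1_supp_continuousD (l := l) sf) HM (ic l).
Qed.

Lemma C1_supp_add f g : C1_supp f -> C1_supp g -> C1_supp (fun x => f x + g x).
Proof.
move=> sf sg; split; last by move=> x Qx; rewrite sf.2 // sg.2 // addr0.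
have D l x := is_derive_add (C1_supp_is_derive l x sf) (C1_supp_is_derive l x sg).
apply: C1_onP => [|l x _]; first exact: openT.
split; first by have [] := D l x.
apply: (continuous_eq_on openT (I : setT x) (g := fun y => 'D_(e l) f y + 'D_(e l) g y)).
  by move=> y _; have [] := D l y.
by apply: continuous_at_add; exact: C1_supp_continuousD.
Qed.

Lemma div_identity_add f g : C1_supp f -> C1_supp g ->
  div_identity f -> div_identity g -> div_identity (fun x => f x + g x).
Proof.
move=> sf sg If Ig.
have E1 := integralD measurableT (C1_supp_integrable sf) (C1_supp_integrable sg).
have E2 := integralD measurableT (C1_supp_integrableD sf) (C1_supp_integrableD sg).
have E0 : (\int[mu']_x ((f x + g x) * t' x)%:E =
    \int[mu']_x ((f x * t' x)%:E + (g x * t' x)%:E))%E.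
  by apply: eq_integral => x _; rewrite -EFinD mulrDl.
apply: (etrans E0 (etrans E1 (etrans (congr2 (fun a b => a + b)%E If Ig) (etrans (esym E2) _)))).
apply: eq_integral => x _; rewrite -EFinD -big_split; congr (_%:E).
apply: eq_bigr => l _ /=; rewrite -mulrDl; congr (_ * _).
by have [_ ->] := is_derive_add (C1_supp_is_derive l x sf) (C1_supp_is_derive l x sg).
Qed.

(** Dominated convergence, with majorants [M] times the absolute values of the densities.
    Convergence and bounds on [Q] suffice, since functions and derivatives vanish on its open
    complement. *)
Lemma div_identity_lim (F : nat -> V -> R) (f : V -> R) (M : R) :
  (forall N, C1_supp (F N)) -> C1_supp f -> (forall N, div_identity (F N)) ->
  (forall x, Q x -> F N x @[N --> \oo] --> f x) ->
  (forall x l, Q x -> 'D_(e l) (F N) x @[N --> \oo] --> 'D_(e l) f x) ->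
  (forall N x, Q x -> `|F N x| <= M) ->
  (forall N x l, Q x -> `|'D_(e l) (F N) x| <= M) ->
  div_identity f.
Proof.
move=> sF sf IF Ff DFf FM DFM.
have M0 : 0 <= M by apply: le_trans (FM 0%N c0 _); rewrite // => i; rewrite subrr normr0 ltW.
have Ff' x : F N x @[N --> \oo] --> f x.
  have [/Ff//|Qx] := pselect (Q x).
  by rewrite sf.2 //; under eq_fun do rewrite (sF _).2 //; exact: cvg_cst.
have DFf' x l : 'D_(e l) (F N) x @[N --> \oo] --> 'D_(e l) f x.
  have [/DFf//|Qx] := pselect (Q x).
  rewrite (C1_supp_D0 _ sf) //; under eq_fun do rewrite (C1_supp_D0 _ (sF _)) //.
  exact: cvg_cst.
have FM' N x : `|F N x| <= M.
  by have [/FM//|Qx] := pselect (Q x); rewrite (sF _).2 // normr0.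
have DFM' N x l : `|'D_(e l) (F N) x| <= M.
  by have [/DFM//|Qx] := pselect (Q x); rewrite (C1_supp_D0 _ (sF _)) // normr0.
have m1 g (sg : C1_supp g) := measurable_int mu' (C1_supp_integrable sg).
have m2 g (sg : C1_supp g) := measurable_int mu (C1_supp_integrableD sg).
have lim1 : (\int[mu']_x (F N x * t' x)%:E)%E @[N --> \oo] --> (\int[mu']_x (f x * t' x)%:E)%E.
  apply: (and3_third (dominated_convergence measurableT (fun N => m1 _ (sF N)) (m1 _ sf) _
    (integrableZl measurableT M (integrable_abse it')) _)).
    apply: aeW => x _; apply: cvg_EFin; first exact: nearW.
    by apply: cvgM; [exact: Ff' | exact: cvg_cst].
  by apply: aeW => x N _; rewrite lee_fin normrM ler_wpM2r.
have lim2 : (\int[mu]_x (\sum_l 'D_(e l) (F N) x * c l x)%:E)%E @[N --> \oo] -->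
    (\int[mu]_x (\sum_l 'D_(e l) f x * c l x)%:E)%E.
  have ig : mu.-integrable setT (fun x => (\sum_l M%:E * `|(c l x)%:E|)%E).
    apply: integrable_sum => // l _.
    exact: (integrableZl measurableT M (integrable_abse (ic l))).
  apply: (and3_third (dominated_convergence measurableT (fun N => m2 _ (sF N)) (m2 _ sf) _ ig _)).
    apply: aeW => x _; apply: cvg_EFin; first exact: nearW.
    apply: (@cvg_big _ _ _ _ _ _ _ _ _ (fun l (N : nat) => 'D_(e l) (F N) x * c l x)
      (fun l => 'D_(e l) f x * c l x)) => [|l _]; first exact: add_continuous.
    by apply: cvgM; [exact: DFf' | exact: cvg_cst].
  apply: aeW => x N _.
  have -> : (\sum_l M%:E * `|(c l x)%:E| = (\sum_l M * `|c l x|)%:E)%E.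
    by rewrite -sumEFin; apply: eq_bigr => l _.
  rewrite lee_fin; apply: le_trans (ler_norm_sum _ _ _) _; apply: ler_sum => l _.
  by rewrite normrM ler_wpM2r.
move: lim1; rewrite (_ : (fun N => _) = (fun N =>
  (\int[mu]_x (\sum_l 'D_(e l) (F N) x * c l x)%:E)%E)); last by apply: funext => N; exact: IF.
by move=> lim1; exact: (cvg_unique _ lim1 lim2).
Qed.

(** The product is C^1 on [B], where [h] is, and zero on the complement of [Q]; these two open sets
    cover the space. *)
Lemma C1_supp_mul (h q : V -> R) : C1_on B h -> smooth q -> (forall x, ~ Q x -> q x = 0) ->
  C1_supp (fun x => h x * q x).
Proof.
move=> ch sq q0; split; last by move=> x Qx; rewrite q0 ?mulr0.
have cB : C1_on B (fun x => h x * q x) by apply: C1_on_mul => //; exact: smooth_C1.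
have z x : (~` Q) x -> h x * q x = (fun=> 0) x by move=> Qx; rewrite q0 ?mulr0.
have cQ : C1_on (~` Q) (fun x => h x * q x).
  have D l x (Qx : (~` Q) x) := derive_eq_on oQ Qx z (is_derive_cst (0 : R) x (e l)).
  apply: C1_onP => // l x Qx; split; first by have [] := D l x Qx.
  apply: (continuous_eq_on oQ Qx (g := fun=> 0)); last exact: cst_continuous.
  by move=> y Qy; have [] := D l y Qy.
apply: C1_onP => [|l x _]; first exact: openT.
have [Qx|Qx] := pselect (Q x).
  split; first by have [+ _] := cB l; apply; exact: QB.
  exact: (C1_on_continuousD oB cB (QB Qx)).
split; first by have [+ _] := cQ l; apply.
exact: (C1_on_continuousD oQ cQ Qx).
Qed.

Hypothesis IdQ : forall q : V -> R, smooth q -> (forall x, ~ Q x -> q x = 0) ->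
  div_identity q.

Let P (f : V -> R) := C1_supp f /\ div_identity f.

(** The weights [tau] and [1 - tau] are moved into the cutoff at each step of the recursion; hence a
    hypothesis quantified over all cutoffs [q]. *)
Lemma bern_class N (F : nat -> V -> R) (tau q : V -> R) : smooth tau ->
  (forall p, (p <= N)%N -> forall q, smooth q -> (forall x, ~ Q x -> q x = 0) ->
     P (fun x => F p x * q x)) ->
  smooth q -> (forall x, ~ Q x -> q x = 0) ->
  P (fun x => bern N (F^~ x) (tau x) * q x).
Proof.
move=> st; elim: N F q => [|N IH] F q FP sq q0 /=; first exact: FP.
have s1 : smooth (fun x => 1 - tau x).
  have -> : (fun x => 1 - tau x) = (fun x => 1 * 1 + (- 1) * tau x).
    by apply: funext => x; ring.
  exact: (smooth_SoP (SoP_add (SoP_mul (@smooth_cst _ n 1) (@smooth_cst _ n 1))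
    (SoP_mul (@smooth_cst _ n (-1)) st))).
have [sA IA] := IH F _ (fun p pN => FP p (leqW pN)) (smooth_mul s1 sq) (fun x Qx => etrans (congr1 _ (q0 x Qx)) (mulr0 _)).
have [sB IB] := IH (fun p => F p.+1) _ (fun p pN => FP p.+1 pN) (smooth_mul st sq)
  (fun x Qx => etrans (congr1 _ (q0 x Qx)) (mulr0 _)).
have -> : (fun x => ((1 - tau x) * bern N (F^~ x) (tau x) +
    tau x * bern N (fun p => F p.+1 x) (tau x)) * q x) =
  (fun x => bern N (F^~ x) (tau x) * ((1 - tau x) * q x) +
    bern N (fun p => F p.+1 x) (tau x) * (tau x * q x)).
  by apply: funext => x; ring.
exact: (conj (C1_supp_add sA sB) (div_identity_add sA sB IA IB)).
Qed.

Definition depends_below (m : nat) (h : V -> R) :=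
  forall x y : V, (forall i : 'I_n, (i < m)%N -> x 0 i = y 0 i) -> h x = h y.

Lemma line_continuous i0 (x : V) s : {for s, continuous (fun s => upd i0 s x)}.
Proof.
suff : upd i0 y x @[y --> s] --> upd i0 s x by [].
move=> A /nbhs_ballP[d /= d0 dA]; apply/nbhs_ballP; exists d => //= y sy.
apply: dA; apply/ballP => // i; rewrite !mxE; case: eqP => _ //.
by rewrite subrr normr0.
Qed.

(** From [(A + d)^2 <= 2 A^2 + 2 d^2] with [|d| <= 1], where [d] is the offset of a mean value point
    inside its grid cell. *)
Lemma sqr_grid_bound (A u t K : R) : 0 <= u <= 1 -> 0 <= t <= 1 ->
  (K * (A + (u - t))) ^+ 2 <= 2 * K ^+ 2 * (A ^+ 2 + 1).
Proof.
move=> /andP[u0 u1] /andP[t0 t1].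
rewrite exprMn [2 * _]mulrC -[leRHS]mulrA ler_wpM2l ?sqr_ge0 //.
have : (u - t) ^+ 2 <= 1.
  by rewrite -real_normK ?num_real // expr_le1 // ler_norml; apply/andP; split; lra.
have := sqr_ge0 (A - (u - t)).
by rewrite !expr2; nra.
Qed.

(** Induction on the number of coordinates on which [h] depends. The Bernstein polynomial in the
    last one has coefficients depending on one coordinate fewer, and it converges to [h] with its
    first derivatives, boundedly on [Q]. *)
Lemma density_below m (h q : V -> R) : (m <= n)%N -> C1_on B h -> depends_below m h ->
  smooth q -> (forall x, ~ Q x -> q x = 0) -> P (fun x => h x * q x).
Proof.
elim: m h q => [|m IH] h q mn ch dh sq q0; split; try exact: C1_supp_mul.
  have -> : (fun x => h x * q x) = (fun x => h 0 * q x).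
    by apply: funext => x; congr (_ * _); exact: dh.
  by apply: IdQ => [|x Qx]; [exact: (smooth_mul (@smooth_cst _ n (h 0)) sq) | rewrite q0 ?mulr0].
pose i0 := Ordinal mn; pose a := c0 0 i0 - r.
have r2 : 0 < 2 * r by rewrite mulr_gt0.
(* Equidistant points of the projection of the cube. The minimum keeps them in the interval for
   every [p], since the derivative formula quantifies over all [p]. *)
pose g N p : R := a + 2 * r * ((minn p N)%:R / N%:R).
have gE N p : (p <= N.+1)%N -> g N.+1 p = a + 2 * r * (p%:R / N.+1%:R).
  by rewrite /g => /minn_idPl ->.
have gab N p : a <= g N.+1 p <= a + 2 * r.
  have /andP[q01 q11] : 0 <= ((minn p N.+1)%:R / N.+1%:R : R) <= 1.
    by rewrite divr_ge0 //= ler_pdivrMr // mul1r ler_nat geq_minr.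
  rewrite /g lerDl lerD2l; apply/andP; split; first exact: mulr_ge0 (ltW r2) q01.
  by rewrite ler_piMr // ltW.
have inI s : a <= s <= a + 2 * r -> `|c0 0 i0 - s| <= r.
  by rewrite /a ler_norml => /andP[? ?]; apply/andP; split; lra.
have inI' s : a <= s <= a + 2 * r -> `|c0 0 i0 - s| < r'.
  by move=> /inI h1; exact: le_lt_trans rr'.
(* The affine map carrying that interval onto [[0, 1]]. *)
pose tau := @affine_coord R n (2 * r)^-1 i0 (- a / (2 * r)).
have tauE (x : V) : x 0 i0 = a + 2 * r * tau x.
  by rewrite /tau /affine_coord; field; rewrite gt_eqF.
have tau01 x : Q x -> 0 <= tau x <= 1.
  move=> /(_ i0); rewrite (tauE x) /a => H.
  have {}H : `|r - 2 * r * tau x| <= r 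
    by have -> : r - 2 * r * tau x = c0 0 i0 - (c0 0 i0 - r + 2 * r * tau x) by ring.
  by move: H; rewrite ler_norml => /andP[H1 H2]; apply/andP; split; nra.
pose H N x := bern N.+1 (fun p => (h \o upd i0 (g N.+1 p)) x) (tau x).
have PH N : P (fun x => H N x * q x).
  apply: bern_class => //; first exact: smooth_affine_coord.
  move=> p _ q' sq' q'0; apply: (IH (h \o upd i0 (g N.+1 p))) => //; first exact: ltnW.
    by apply: (C1_on_upd r0 rr') => //; exact: inI'.
  move=> x y xy; apply: dh => i im; rewrite !mxE; case: eqP => // /eqP ii0; apply: xy.
  by rewrite ltn_neqAle -ltnS im andbT.
have dtau l x : is_derive x (e l) tau ((2 * r)^-1 * e l 0 i0 * 1).
  by apply: (@is_derive_comp_affine _ _ id); exact: is_derive_id.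
pose dH l N x := bern N.+1 (fun p => if l == i0 then 0 else 'D_(e l) h (upd i0 (g N.+1 p) x)) (tau x)
  + (2 * r)^-1 * e l 0 i0 * 1 *
    (N.+1%:R * bern N (fun p => h (upd i0 (g N.+1 p.+1) x) - h (upd i0 (g N.+1 p) x)) (tau x)).
have HD l N x : Q x -> is_derive x (e l) (H N) (dH l N x).
  move=> Qx; apply: (@is_derive_bern R n N.+1 (fun p => h \o upd i0 (g N.+1 p)) _ tau _ x (e l)) => // p.
  exact: (is_derive_upd r0 rr' l ch (inI' _ (gab N p)) (QB Qx)).
(* The increments in the derivative along [i0] are difference quotients over one grid cell; the mean
   value theorem turns them into values of the partial derivative of [h]. *)
have xi_ex x N p : Q x -> exists th, (p <= N)%N -> 0 <= th <= 1 /\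
    (2 * r)^-1 * (N.+1%:R * (h (upd i0 (g N.+1 p.+1) x) - h (upd i0 (g N.+1 p) x))) =
    'D_(e i0) h (upd i0 (th * (2 * r / N.+1%:R) + g N.+1 p) x) /\
    a <= th * (2 * r / N.+1%:R) + g N.+1 p <= a + 2 * r.
  move=> Qx; have [pN|//] := leqP p N; last by exists 0.
  have gS : g N.+1 p.+1 = 2 * r / N.+1%:R + g N.+1 p.
    by rewrite !gE // ?(leqW pN) // -[p.+1%:R]natr1; field; rewrite addrC natr1 pnatr_eq0.
  have thab th : 0 <= th <= 1 -> a <= th * (2 * r / N.+1%:R) + g N.+1 p <= a + 2 * r.
    move=> /andP[th0 th1]; have /andP[g1 _] := gab N p; have /andP[_ g2] := gab N p.+1.
    have K0 : 0 <= 2 * r / N.+1%:R by rewrite divr_ge0 // ltW.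
    rewrite gS in g2; apply/andP; split.
      by apply: le_trans g1 _; rewrite lerDr mulr_ge0.
    by apply: le_trans g2; rewrite lerD2r ler_piMl.
  have [th th01|th th01 E] := @MVT_line _ _ h (upd i0 (g N.+1 p) x) (e i0) (2 * r / N.+1%:R).
    rewrite -upd_add; have [+ _] := ch i0; apply; apply: QB; apply: upd_cube => //.
    by apply: inI; exact: thab.
  exists th => _; split=> //; split; last exact: thab.
  rewrite gS upd_add E -upd_add; field; rewrite addrC natr1 pnatr_eq0 /=.
  by rewrite gt_eqF.
have [Mh Mh0 hM] := bounded_on_compact (@cube_compact _ _ c0 r)
  (fun x Qx => C1_on_continuous oB ch (QB Qx)).
have [Md Hd] : {Md : 'I_n -> R & forall l, 0 <= Md l /\ forall x, Q x -> `|'D_(e l) h x| <= Md l}.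
  apply: (@boolp.choice _ _ (fun l M => 0 <= M /\ forall x, Q x -> `|'D_(e l) h x| <= M)) => l.
  have [M M0 HM] := bounded_on_compact (@cube_compact _ _ c0 r)
    (fun x Qx => C1_on_continuousD (j := l) oB ch (QB Qx)).
  by exists M.
have dHi0 x N : Q x -> dH i0 N x = bern N (fun p => (2 * r)^-1 * (N.+1%:R *
    (h (upd i0 (g N.+1 p.+1) x) - h (upd i0 (g N.+1 p) x)))) (tau x).
  move=> Qx; rewrite /dH eqxx bern_const add0r !bernZ mxE !eqxx /=.
  by rewrite !mulr1.
have dHl l x N : l != i0 -> dH l N x =
    bern N.+1 (fun p => 'D_(e l) h (upd i0 (g N.+1 p) x)) (tau x).
  move=> li; rewrite /dH (negbTE li) mxE eqxx /= [i0 == l]eq_sym (negbTE li).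
  by rewrite mulr0 !mul0r addr0.
have H_M x N : Q x -> `|H N x| <= Mh.
  move=> Qx; apply: bern_abs => [|p _]; first exact: tau01.
  by apply: hM; apply: upd_cube => //; apply: inI.
have dH_M l x N : Q x -> `|dH l N x| <= Md l.
  move=> Qx; have [->|li] := eqVneq l i0; last first.
    rewrite dHl //; apply: bern_abs => [|p _]; first exact: tau01.
    by have [_] := Hd l; apply; apply: upd_cube => //; apply: inI.
  rewrite dHi0 //; apply: bern_abs => [|p pN]; first exact: tau01.
  have [th /(_ pN)[_ [-> thab]]] := xi_ex x N p Qx.
  by have [_] := Hd i0; apply; apply: upd_cube => //; exact: inI.
have xab (x : V) : Q x -> a <= x 0 i0 <= a + 2 * r.
  move=> Qx; have /andP[t0 t1] := tau01 x Qx; rewrite (tauE x).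
  by apply/andP; split; nra.
(* The constant is [2 * (2 * r)^2], from [sqr_grid_bound] with zero offset. *)
have sqgrid (x : V) N p : Q x -> (p <= N.+1)%N ->
    (g N.+1 p - x 0 i0) ^+ 2 <= 8 * r ^+ 2 / N.+1%:R ^+ 2 * ((p%:R - N.+1%:R * tau x) ^+ 2 + 1).
  move=> Qx pN; rewrite gE // (tauE x).
  have -> : a + 2 * r * (p%:R / N.+1%:R) - (a + 2 * r * tau x) =
      2 * r / N.+1%:R * ((p%:R - N.+1%:R * tau x) + (0 - 0)).
    by field; rewrite addrC natr1 pnatr_eq0.
  apply: le_trans (sqr_grid_bound _ _ _ _) _; rewrite ?lexx ?ler01 //.
  by rewrite le_eqVlt; apply/orP; left; apply/eqP; rewrite exprMn exprVn exprMn; ring.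
have H_cvg x : Q x -> H N x @[N --> \oo] --> h x.
  move=> Qx; rewrite -[in X in _ --> X](upd_id i0 x).
  apply: (@bern_cvg _ (fun s => h (upd i0 s x)) (x 0 i0) (tau x) (8 * r ^+ 2) a (a + 2 * r) Mh S (fun N p => g N.+1 p)) => //.
  - exact: tau01.
  - by rewrite mulr_ge0 // sqr_ge0.
  - exact: xab.
  - apply: (@continuous_comp _ _ _ (fun s => upd i0 s x) h); first exact: line_continuous.
    by rewrite upd_id; exact: (C1_on_continuous oB ch (QB Qx)).
  - by move=> y /inI yab; apply: hM; exact: upd_cube.
  - by move=> N p pN; exact: sqgrid.
have dH_cvg l x : Q x -> dH l N x @[N --> \oo] --> 'D_(e l) h x.
  move=> Qx; rewrite -[in X in _ --> X](upd_id i0 x).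
  have kc : {for x 0 i0, continuous (fun s => 'D_(e l) h (upd i0 s x))}.
    apply: (@continuous_comp _ _ _ (fun s => upd i0 s x) ('D_(e l) h)); first exact: line_continuous.
    by rewrite upd_id; exact: (C1_on_continuousD oB ch (QB Qx)).
  have kM y : a <= y <= a + 2 * r -> `|'D_(e l) h (upd i0 y x)| <= Md l.
    by move=> /inI yab; have [_] := Hd l; apply; exact: upd_cube.
  have D0 : 0 <= 8 * r ^+ 2 by rewrite mulr_ge0 // sqr_ge0.
  have [li|li] := eqVneq l i0; last first.
    under eq_fun do rewrite dHl //.
    apply: (@bern_cvg _ (fun s => 'D_(e l) h (upd i0 s x)) (x 0 i0) (tau x) (8 * r ^+ 2) a (a + 2 * r) (Md l) S (fun N p => g N.+1 p)) => //.
    + exact: tau01.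
    + exact: xab.
    + by move=> N p pN; exact: sqgrid.
  have [th thP] := boolp.choice (fun Np : nat * nat => xi_ex x Np.1 Np.2 Qx).
  (* The chosen mean value points; [a] is a default beyond the degree [N]. *)
  pose s N p := if (p <= N)%N then th (N, p) * (2 * r / N.+1%:R) + g N.+1 p else a.
  have dHE N : dH l N x = bern N (fun p => 'D_(e l) h (upd i0 (s N p) x)) (tau x).
    rewrite li dHi0 //; apply: eq_bern => p pN; rewrite /s pN.
    by have [_ [-> _]] := thP (N, p) pN.
  under eq_fun do rewrite dHE.
  apply: (@bern_cvg _ (fun s => 'D_(e l) h (upd i0 s x)) (x 0 i0) (tau x) (8 * r ^+ 2) a (a + 2 * r) (Md l) id s) => //.
  - exact: tau01.
  - exact: xab.
  - by move=> N p pN; rewrite /s pN; have [_ []] := thP (N, p) pN.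
  - move=> N p pN; rewrite /s pN; have [th01 _] := thP (N, p) pN.
    rewrite gE ?(leqW pN) // (tauE x).
    (* The degree is [N] but the mesh is [1 / (N + 1)]: [(p + th) - (N + 1) tau] splits as
       [(p - N tau) + (th - tau)]. *)
    have -> : th (N, p) * (2 * r / N.+1%:R) + (a + 2 * r * (p%:R / N.+1%:R)) - (a + 2 * r * tau x) =
      2 * r / N.+1%:R * ((p%:R - N%:R * tau x) + (th (N, p) - tau x)).
      have NS : (N.+1%:R : R) = N%:R + 1 by rewrite natr1.
      by rewrite NS; field; rewrite natr1 pnatr_eq0.
    apply: le_trans (sqr_grid_bound _ _ th01 (tau01 x Qx)) _.
    by rewrite le_eqVlt; apply/orP; left; apply/eqP; rewrite exprMn exprVn exprMn; ring.
have [Mq HMq] := vanishing_bounded (smooth_continuous sq) q0.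
have sq1 : C1_supp q by split=> //; exact: (smooth_C1 openT sq).
have [Mdq Hdq] : {Mdq : 'I_n -> R & forall l, forall x, `|'D_(e l) q x| <= Mdq l}.
  apply: (@boolp.choice _ _ (fun l M => forall x, `|'D_(e l) q x| <= M)) => l.
  exact: (vanishing_bounded (C1_supp_continuousD (l := l) sq1) (fun x => C1_supp_D0 l sq1)).
have HqD l N x : Q x -> 'D_(e l) (fun x => H N x * q x) x = H N x * 'D_(e l) q x + q x * dH l N x.
  by move=> Qx; have [_ ->] := is_derive_mul (HD l N x Qx) (smooth_is_derive l x sq).
have hqD l x : Q x -> 'D_(e l) (fun x => h x * q x) x = h x * 'D_(e l) q x + q x * 'D_(e l) h x.
  move=> Qx; have hD : is_derive x (e l) h ('D_(e l) h x).
    by apply: derivableP; have [+ _] := ch l; apply; exact: QB.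
  by have [_ ->] := is_derive_mul hD (smooth_is_derive l x sq).
have Mq0 : 0 <= Mq by apply: le_trans (HMq 0).
have Mdq0 l : 0 <= Mdq l by apply: le_trans (Hdq l 0).
(* Summing over [l] gives one bound for the functions and for all their partial derivatives. *)
pose Mt := Mh * Mq + \sum_l (Mh * Mdq l + Mq * Md l).
have Mt0 l : 0 <= Mh * Mdq l + Mq * Md l.
  by apply: addr_ge0; apply: mulr_ge0 => //; have [] := Hd l.
apply: (@div_identity_lim (fun N x => H N x * q x) _ Mt).
- by move=> N; have [] := PH N.
- exact: C1_supp_mul.
- by move=> N; have [] := PH N.
- by move=> x Qx; apply: cvgM; [exact: H_cvg | exact: cvg_cst].
- move=> x l Qx; rewrite hqD //; under eq_fun do rewrite HqD //.
  by apply: cvgD; apply: cvgM; try exact: cvg_cst; [exact: H_cvg | exact: dH_cvg].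
- move=> N x Qx; rewrite normrM; apply: ler_wpDr; first exact: sumr_ge0.
  by apply: ler_pM => //; exact: H_M.
- move=> N x l Qx; rewrite HqD //; apply: ler_wpDl; first exact: mulr_ge0.
  rewrite (bigD1 l) //=; apply: ler_wpDr; first exact: sumr_ge0.
  apply: le_trans (ler_normD _ _) _; rewrite !normrM.
  by apply: lerD; apply: ler_pM => //; [exact: H_M | exact: dH_M].
Qed.

Lemma div_identity_C1 (h q : V -> R) : C1_on B h -> smooth q ->
  (forall x, ~ Q x -> q x = 0) -> C1_supp (fun x => h x * q x) /\ div_identity (fun x => h x * q x).
Proof.
move=> ch sq q0; apply: (@density_below n) => // x y xy; congr h.
by apply/rowP => i; exact: xy.
Qed.

End Density.

(** * Functions orthogonal to all bumps *)

Section BoxCover.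
Variables (R : realType) (n : nat).
Notation V := 'rV[R]_n.

Definition rat_point (c : 'rV[rat]_n) : V := map_mx ratr c.

Lemma rat_ball_sub (U : set V) (x : V) : open U -> U x ->
  exists (c : 'rV[rat]_n) (q : rat), [/\ 0 < (ratr q : R),
    ball (rat_point c) (ratr q) x & ball (rat_point c) (ratr q + ratr q) `<=` U].
Proof.
move=> oU Ux.
have /nbhs_ballP[d /= d0 dU] : nbhs x U by exact: open_nbhs_nbhs.
(* With [q < d / 4], points of the doubled ball lie within [3 q < d] of [x]. *)
have [q] := @rat_in_itvoo R 0 (d / 4) (divr_gt0 d0 (ltr0n _ 4)).
rewrite in_itv /= => /andP[q0 qd].
have cex i : exists c : rat, `|ratr c - x 0 i| < ratr q.
  have xq : x 0 i - ratr q < x 0 i + ratr q by rewrite ltrD2l gtrN.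
  have [c] := rat_in_itvoo xq; rewrite in_itv /= => /andP[c1 c2]; exists c.
  by rewrite ltr_norml; apply/andP; split; lra.
have [cf cP] := boolp.choice cex.
exists (\row_i cf i), q; split => //.
  by apply/ballP => // i; rewrite !mxE.
have qq0 : 0 < ratr q + ratr q :> R by rewrite addr_gt0.
move=> y /(ballP _ _ qq0) cy; apply: dU; apply/ballP => // i.
have := cy i; rewrite !mxE => cyi.
rewrite -(subrK (ratr (cf i)) (x 0 i)) -addrA.
apply: le_lt_trans (ler_normD _ _) _; rewrite distrC.
by have := cP i; lra.
Qed.

Definition nth_ball (k : nat) : ('rV[rat]_n * rat) :=
  odflt (0, 0) (unpickle k).

(** A Lindelof argument: around each point a ball with rational centre and radius fits in the given
    ball, and there are countably many of these. *)
Lemma ae_local (nu : {measure set (Rn_borel R n) -> \bar R}) (U : set V)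
    (Pr : V -> Prop) :
  (forall x, U x -> exists2 r : R, 0 < r & {ae nu, forall y, ball x r y -> Pr y}) ->
  {ae nu, forall x, U x -> Pr x}.
Proof.
move=> H.
(* Each rational ball enters conditionally: where the property fails to hold almost everywhere the
   clause is vacuous, so all balls can be intersected. *)
have : {ae nu, forall x, forall k : nat, let cq := nth_ball k in
    {ae nu, forall y, ball (rat_point cq.1) (ratr cq.2) y -> Pr y} ->
    ball (rat_point cq.1) (ratr cq.2) x -> Pr x}.
  apply: ae_foralln => k /=.
  have [aeP|naeP] := pselect {ae nu, forall y, ball (rat_point (nth_ball k).1)
    (ratr (nth_ball k).2) y -> Pr y}; last by apply: aeW => x /naeP.
  by apply: (@filterS _ _ (ae_filter_ringOfSetsType nu) _ _ _ aeP) => x Hx _.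
apply: (@filterS _ _ (ae_filter_ringOfSetsType nu)) => x Hx Ux.
have [r r0 aeP] := H x Ux.
have [c [q [q0 xq qU]]] := rat_ball_sub (@ball_open _ _ x r) (@ballxx _ _ x r r0).
have := Hx (pickle (c, q)); rewrite /nth_ball pickleK /=; apply => //.
apply: (@filterS _ _ (ae_filter_ringOfSetsType nu) _ _ _ aeP) => y Hy cy; apply: Hy; apply: qU.
by apply: le_ball cy; rewrite lerDl ltW.
Qed.

Lemma ball_box (c : V) (r : R) : 0 < r ->
  ball c r = box (c - const_mx r) (c + const_mx r).
Proof.
move=> r0; apply/seteqP; split => x.
  by move=> /(ballP _ _ r0) H i; have := H i; rewrite !mxE ltr_distlC.
by move=> H; apply/ballP => // i; have := H i; rewrite !mxE ltr_distlC.
Qed.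

Lemma box_open (a b : V) : open (box a b).
Proof.
rewrite openE => x abx; apply/nbhs_ballP.
have d0 i : 0 < Num.min (x 0 i - a 0 i) (b 0 i - x 0 i).
  by have /andP[? ?] := abx i; rewrite lt_min !subr_gt0; apply/andP.
(* The value 1 keeps [d] positive when [n = 0]. *)
pose d := \big[Num.min/1]_i Num.min (x 0 i - a 0 i) (b 0 i - x 0 i).
have dd : 0 < d by rewrite /d; elim/big_ind: _ => // u v u0 v0; rewrite lt_min u0.
exists d => //= y /(ballP _ _ dd) xy i; have := xy i.
have : d <= Num.min (x 0 i - a 0 i) (b 0 i - x 0 i) by rewrite /d; exact: bigmin_le_cond.
by rewrite le_min ltr_norml => /andP[? ?] /andP[? ?]; apply/andP; split; lra.
Qed.

(** A pi-system generating the Borel sets and consisting of sets whose indicators are limits of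
    bumps. *)
Definition boxes : set (set V) := [set S | exists a b, S = box a b].

Lemma boxes_setI : setI_closed boxes.
Proof.
move=> _ _ [a [b ->]] [a' [b' ->]].
exists (\row_i Num.max (a 0 i) (a' 0 i)), (\row_i Num.min (b 0 i) (b' 0 i)).
apply/seteqP; split => [x [H H'] i|x H].
  by rewrite !mxE gt_max lt_min; have /andP[-> ->] := H i; have /andP[-> ->] := H' i.
split=> i; have := H i; rewrite !mxE gt_max lt_min.
  by move=> /andP[/andP[-> _] /andP[-> _]].
by move=> /andP[/andP[_ ->] /andP[_ ->]].
Qed.

Lemma open_sigma_boxes (U : set V) : open U -> <<s boxes >> U.
Proof.
move=> oU; have [sig0 _ sigU] := smallest_sigma_algebra [set: V] boxes.
pose F (k : nat) : set V := let cq := nth_ball k in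
  if `[< 0 < (ratr cq.2 : R) /\ ball (rat_point cq.1) (ratr cq.2 + ratr cq.2) `<=` U >]
  then ball (rat_point cq.1) (ratr cq.2) else set0.
have -> : U = \bigcup_k F k.
  apply/seteqP; split => [x Ux|x [k _]].
    have [c [q [q0 xq qU]]] := rat_ball_sub oU Ux.
    exists (pickle (c, q)) => //; rewrite /F /nth_ball pickleK /=.
    by case: asboolP => // -[].
  rewrite /F /=; case: asboolP => // -[q0 qU] xq; apply: qU.
  by apply: le_ball xq; rewrite lerDl ltW.
apply: sigU => k; rewrite /F; case: asboolP => // -[q0 _].
by apply: sub_sigma_algebra; rewrite ball_box //; exists (rat_point (nth_ball k).1 - const_mx (ratr (nth_ball k).2)),
  (rat_point (nth_ball k).1 + const_mx (ratr (nth_ball k).2)).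
Qed.

Section Vanishing.
Variables (nu : {measure set (Rn_borel R n) -> \bar R}) (f : V -> R).
Hypothesis fi : nu.-integrable setT (fun x => (f x)%:E).

Lemma integral_mul_lim0 (phi : nat -> V -> R) (S : set (Rn_borel R n)) :
  measurable S ->
  (forall k, measurable_fun (setT : set (Rn_borel R n)) (phi k : Rn_borel R n -> R)) ->
  (forall k x, `|phi k x| <= 1) ->
  (forall x, phi k x @[k --> \oo] --> (\1_S x : R)) ->
  (forall k, (\int[nu]_x (phi k x * f x)%:E = 0)%E) ->
  (\int[nu]_x (\1_S x * f x)%:E = 0)%E.
Proof.
move=> mS mphi phi1 phil phi0.
have bounded1 (g : Rn_borel R n -> R) : (forall x, `|g x| <= 1) ->
    [bounded g x | x in (setT : set (Rn_borel R n))].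
  move=> g1; exists 1; split; first exact: num_real.
  by move=> N N1 x _; apply: le_trans (g1 x) (ltW N1).
have m1 k := measurable_int nu (integrableMr measurableT (mphi k) (bounded1 _ (phi1 k)) fi).
have i1 : forall x, `|\1_S x : R| <= 1.
  by move=> x; rewrite indicE; case: (x \in S); rewrite ?normr1 ?normr0.
have m2 := measurable_int nu (integrableMr measurableT
  (measurable_realfun.measurable_indic mS : measurable_fun setT (\1_S : Rn_borel R n -> R)) (bounded1 _ i1) fi).
have lim : (\int[nu]_x (phi k x * f x)%:E)%E @[k --> \oo] --> (\int[nu]_x (\1_S x * f x)%:E)%E.
  apply: (and3_third (dominated_convergence measurableT m1 m2 _ (integrable_abse fi) _)).
    apply: aeW => x _; apply: cvg_EFin; first exact: nearW.
    by apply: cvgM; [exact: phil | exact: cvg_cst].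
  by apply: aeW => x k _; rewrite lee_fin normrM ler_piMl.
have lim0 : (\int[nu]_x (phi k x * f x)%:E)%E @[k --> \oo] --> (0 : \bar R)%E.
  by under eq_fun do rewrite phi0; exact: cvg_cst.
exact: (cvg_unique _ lim lim0).
Qed.

Lemma integral_restrict_indic (S : set (Rn_borel R n)) :
  (\int[nu]_(x in S) (f x)%:E = \int[nu]_x (\1_S x * f x)%:E)%E.
Proof.
rewrite integral_mkcond; apply: eq_integral => x _; rewrite /patch indicE.
by case: ifP => _; rewrite ?mul1r ?mul0r.
Qed.

(** Dominated convergence passes from bumps to boxes and Dynkin induction from boxes to all
    measurable sets; a function with zero integral on all of them is zero almost everywhere. *)
Lemma ae_eq0_of_boxbump :
  (forall (k : nat) a b, (\int[nu]_x (boxbump k%:R a b x * f x)%:E = 0)%E) ->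
  {ae nu, forall x, f x = 0}.
Proof.
move=> H.
have Hbox a b : (\int[nu]_x (\1_(box a b) x * f x)%:E = 0)%E.
  apply: (integral_mul_lim0 (phi := fun k => boxbump k%:R a b)) => //.
  - exact: (open_measurable_Rn (@box_open a b)).
  - by move=> k; apply: continuous_measurable_Rn; apply: smooth_continuous; exact: smooth_boxbump.
  - by move=> k x; have /andP[h0 h1] := boxbump_ge0_le1 k%:R a b x; rewrite ger0_norm.
  - by move=> x; exact: boxbump_cvg.
(* The Dynkin induction also needs the whole space, which is exhausted by the boxes []-k, k[^n]. *)
have HT : (\int[nu]_x (\1_(setT : set V) x * f x)%:E = 0)%E.
  pose S (k : nat) := box (const_mx (- k%:R)) (const_mx k%:R : V).
  apply: (integral_mul_lim0 (phi := fun k => \1_(S k))) => //.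
  - move=> k; apply: measurable_realfun.measurable_indic.
    exact: (open_measurable_Rn (@box_open (const_mx (- k%:R)) (const_mx k%:R))).
  - by move=> k x; rewrite indicE; case: (x \in _); rewrite ?normr1 ?normr0.
  - move=> x; rewrite indicT.
    have nk := @nbhs_infty_ger R (\sum_i `|x 0 i| + 1).
    have nk1 : \forall k \near \oo, (fun=> 1 : R) k = (\1_(S k) x : R).
      apply: filterS nk => k xk; rewrite indicE mem_set // => i.
      rewrite !mxE -ltr_norml; apply: lt_le_trans xk.
      rewrite (bigD1 i) //= -addrA ltrDl ltr_wpDl ?ltr01 //.
      exact: sumr_ge0.
    exact: (cvg_trans (near_eq_cvg nk1) (cvg_cst (1 : R))).
  - by move=> k; exact: Hbox.
have mE : @measurable _ (Rn_borel R n) = <<s boxes >>.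
  rewrite eqEsubset; split => [A|A].
    by apply: smallest_sub; [exact: smallest_sigma_algebra | exact: open_sigma_boxes].
  apply: smallest_sub; first exact: smallest_sigma_algebra.
  by move=> _ [a [b ->]]; apply: sub_sigma_algebra; exact: box_open.
have all0 (X : set (Rn_borel R n)) : measurable X -> (\int[nu]_(x in X) (f x)%:E = 0)%E.
  move=> mX; have sX : <<s boxes >> X by rewrite -mE.
  apply: (dynkin_induction (P := fun Y => (\int[nu]_(x in Y) (f x)%:E = 0)%E) mE boxes_setI _ _ _ _ sX).
  - by rewrite integral_restrict_indic; exact: HT.
  - by move=> _ [a [b ->]]; rewrite integral_restrict_indic.
  - move=> A mA A0.
    have dA : [disjoint A & ~` A] by apply/disj_setPCl.
    have := integral_setU (f := fun x => (f x)%:E) nu mA (measurableC mA).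
    rewrite setUv => /(_ (measurable_int nu fi) dA).
    rewrite A0 add0e => <-; rewrite integral_restrict_indic; exact: HT.
  - move=> F mF tF F0; rewrite integral_bigcup //.
      by rewrite eseries0 // => k _ _; exact: F0.
    by apply: (integrableS measurableT) fi => //; exact: bigcupT_measurable.
have z : nu.-integrable setT (fun x => (f x)%:E) := fi.
have : ae_eq nu setT (fun x => (f x)%:E) (cst 0%E).
  apply: integral_ae_eq => // E _ mE'; rewrite integral0; exact: all0.
apply: (@filterS _ _ (ae_filter_ringOfSetsType nu)) => x /(_ I).
by move=> [].
Qed.

End Vanishing.
End BoxCover.

(** * Involutivity and the contraction identity *)

Section Involutivity.
Variables (R : realType) (n k : nat) (O : set 'rV[R]_n) (V : 'rV[R]_n -> 'M[R]_n).
Notation e := (evec R).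
Hypotheses (oO : open O) (VC1 : C1_distribution k O V).

Let Vsym x : O x -> (V x)^T = V x. Proof. by move=> /(VC1.1 x)[]. Qed.
Let Videm x : O x -> V x *m V x = V x. Proof. by move=> /(VC1.1 x)[]. Qed.

(* The rows of [1 - V] span the annihilator of the distribution. *)
Definition conormal (i j : 'I_n) (x : 'rV[R]_n) : R := (i == j)%:R - V x i j.
Definition conormal_row (i : 'I_n) (x : 'rV[R]_n) : 'rV[R]_n := \row_j conormal i j x.
(** Only the antisymmetric part of this matrix is the exterior derivative. So the latter vanishes on
    the plane exactly when [V x *m dconormal i x *m V x] is symmetric. *)
Definition dconormal (i : 'I_n) (x : 'rV[R]_n) : 'M[R]_n :=
  \matrix_(l, j) 'D_(e l) (conormal i j) x.

Lemma conormal_C1 i j : C1_on O (conormal i j).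
Proof.
have D l x : O x -> is_derive x (e l) (conormal i j) (0 + - 'D_(e l) (fun x => V x i j) x).
  move=> Ox; apply: (is_derive_add (is_derive_cst ((i == j)%:R : R) x (e l))).
  apply: is_deriveN; apply: derivableP; have [+ _] := VC1.2 i j l; exact.
apply: C1_onP => // l x Ox; split; first by have [] := D l x Ox.
apply: (continuous_eq_on oO Ox (g := fun y => (-1) * 'D_(e l) (fun x => V x i j) y)).
  by move=> y /(D l)[_ ->]; rewrite add0r mulN1r.
apply: continuous_at_mul; first exact: cst_continuous.
exact: (C1_on_continuousD oO (VC1.2 i j) Ox).
Qed.

Lemma conormal_rowE i x : conormal_row i x = delta_mx 0 i *m (1%:M - V x).
Proof. by rewrite -rowE; apply/rowP => j; rewrite !mxE. Qed.

Lemma conormal_perp i x : O x -> conormal_row i x *m (V x)^T = 0.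
Proof.
by move=> Ox; rewrite conormal_rowE -mulmxA mulmxBl mul1mx Vsym // Videm // subrr mulmx0.
Qed.

Lemma tangent_conormal (u : fock R n) x : O x ->
  tangent_to (V x) u <-> forall i, annv (conormal_row i x) u = 0.
Proof.
move=> Ox; split=> [tan i|H a aP]; first by apply: tan; exact: conormal_perp.
have -> : a = \sum_i a 0 i *: conormal_row i x.
  have aV : a *m V x = 0 by rewrite -(Vsym Ox).
  have aE : a = a *m (1%:M - V x) by rewrite mulmxBr mulmx1 aV subr0.
  rewrite {1}aE mulmx_sum_row; apply: eq_bigr => i _; congr (_ *: _).
  by apply/rowP => j; rewrite !mxE.
rewrite (_ : annv _ u = \sum_i a 0 i *: annv (conormal_row i x) u).
  by rewrite big1 // => i _; rewrite H scaler0.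
elim/big_rec2: _ => [|i w b _ <-].
  by rewrite /annv big1 // => j _; rewrite mxE scale0r.
by rewrite annvD annvZ.
Qed.

Lemma sub_conormal (b : 'rV[R]_n) x : O x ->
  (b <= V x)%MS <-> forall i, (conormal_row i x *m b^T) 0 0 = 0.
Proof.
move=> Ox; split=> [/submxP[y ->] i|H].
  by rewrite trmx_mul mulmxA conormal_perp // mul0mx mxE.
suff bV : b = b *m V x by rewrite bV submxMl.
have : (1%:M - V x) *m b^T = 0.
  apply/row_matrixP => i; rewrite row0 row_mul rowE -conormal_rowE.
  by apply/rowP => z; rewrite ord1 H mxE.
move/(congr1 trmx); rewrite trmx_mul trmxK linearB /= trmx1 Vsym // trmx0.
by rewrite mulmxBr mulmx1 => /eqP; rewrite subr_eq0 => /eqP.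
Qed.

(** The Cartan formula [a([w, w']) = da(w, w')] for fields killed by [a], with the sign of the
    present bracket, opposite to the usual one. *)
Lemma bracket_conormal (w w' : 'rV[R]_n -> 'rV[R]_n) i x :
  C1_vf O w -> C1_vf O w' ->
  (forall y, O y -> (w y <= V y)%MS) -> (forall y, O y -> (w' y <= V y)%MS) -> O x ->
  (conormal_row i x *m (bracket w w' x)^T) 0 0 =
  (w x *m dconormal i x *m (w' x)^T) 0 0 - (w' x *m dconormal i x *m (w x)^T) 0 0.
Proof.
move=> cw cw' wV w'V Ox.
have Dw (u : 'rV[R]_n -> 'rV[R]_n) v j : C1_vf O u ->
    ('D_v u x) 0 j = \sum_l v 0 l * 'D_(e l) (fun y => u y 0 j) x.
  move=> cu; have D j' := C1_on_derive v oO (cu j') Ox.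
  rewrite derive_mx; last by apply/derivable_mxP => a b; rewrite ord1; have [] := D b.
  by rewrite mxE; have [_ ->] := D j.
(* Differentiate [a(u) = 0], valid on all of [O], to trade derivatives of the field for derivatives
   of the form. *)
have leib (u : 'rV[R]_n -> 'rV[R]_n) l : C1_vf O u -> (forall y, O y -> (u y <= V y)%MS) ->
    \sum_j conormal i j x * 'D_(e l) (fun y => u y 0 j) x =
    - \sum_j 'D_(e l) (conormal i j) x * u x 0 j.
  move=> cu uV.
  have Dj j : is_derive x (e l) (fun y => conormal i j y * u y 0 j)
      (conormal i j x * 'D_(e l) (fun y => u y 0 j) x + u x 0 j * 'D_(e l) (conormal i j) x).
    apply: is_derive_mul; apply: derivableP.
      by have [+ _] := conormal_C1 i j l; exact.
    by have [+ _] := cu j l; exact.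
  have S := is_derive_sum Dj.
  have Z y : O y -> (\sum_j (fun y => conormal i j y * u y 0 j)) y = (fun=> 0 : R) y.
    move=> Oy; rewrite fct_sumE; have /(sub_conormal _ Oy)/(_ i) H0 := uV y Oy.
    transitivity ((conormal_row i y *m (u y)^T) 0 0) => //.
    by rewrite [RHS]mxE; apply: eq_bigr => j _; rewrite !mxE.
  have [_ Z0] := derive_eq_on oO Ox Z (is_derive_cst (0 : R) x (e l)).
  have [_] := S; rewrite Z0 big_split /= => /esym/eqP; rewrite addr_eq0 => /eqP ->.
  by congr (- _); apply: eq_bigr => j _; rewrite mulrC.
have half (u u' : 'rV[R]_n -> 'rV[R]_n) : C1_vf O u -> (forall y, O y -> (u y <= V y)%MS) ->
    \sum_j conormal i j x * ('D_(u' x) u x) 0 j = - (u' x *m dconormal i x *m (u x)^T) 0 0.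
  move=> cu uV; under eq_bigr do rewrite Dw // mulr_sumr.
  rewrite exchange_big /= -mulmxA mxE -sumrN; apply: eq_bigr => l _.
  under eq_bigr do rewrite mulrCA.
  rewrite -mulr_sumr leib // mulrN; congr (- (_ * _)).
  by rewrite mxE; apply: eq_bigr => j _; rewrite !mxE.
rewrite [LHS]mxE.
rewrite (eq_bigr (fun j => conormal i j x * ('D_(w' x) w x) 0 j - conormal i j x * ('D_(w x) w' x) 0 j)); last first.
  by move=> j _; rewrite !mxE mulrBr.
by rewrite sumrB !half // opprK addrC.
Qed.

(** Symmetry on the plane makes the two terms of [bracket_conormal] cancel. Conversely, the rows of
    [V] are C^1 fields tangent to [V], and testing with rows [a] and [b] reads off the two entries
    to be compared. *)
Lemma involutive_conormal x : O x -> involutive_at O V x <->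
  forall i, (V x *m dconormal i x *m V x)^T = V x *m dconormal i x *m V x.
Proof.
move=> Ox; split=> [inv i|sym w w' cw cw' wV w'V]; last first.
  apply/(sub_conormal _ Ox) => i; rewrite bracket_conormal //.
  have wE (u : 'rV[R]_n) : (u <= V x)%MS -> u = u *m V x.
    by move=> /submxP[y ->]; rewrite -mulmxA Videm.
  have E1 := wE _ (wV x Ox); have E2 := wE _ (w'V x Ox).
  set M := dconormal i x.
  have -> : w x *m M *m (w' x)^T = w x *m (V x *m M *m V x) *m (w' x)^T.
    by rewrite {1}E1 {1}E2 trmx_mul Vsym // !mulmxA.
  have -> : w' x *m M *m (w x)^T = (w x *m (V x *m M *m V x) *m (w' x)^T)^T.
    rewrite -[in RHS](sym i) trmx_mul trmx_mul !trmxK.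
    by rewrite {1}E1 {1}E2 trmx_mul Vsym // !mulmxA.
  by rewrite [X in _ - X]mxE subrr.
apply/matrixP => a b; rewrite mxE.
have rowC1 c : C1_vf O (fun y => row c (V y)).
  by move=> j; have := VC1.2 c j; congr (C1_on _ _); apply: funext => y; rewrite mxE.
have := inv _ _ (rowC1 a) (rowC1 b) (fun y _ => row_sub a (V y)) (fun y _ => row_sub b (V y)).
move=> /(sub_conormal _ Ox)/(_ i).
rewrite bracket_conormal //; try by move=> y _; exact: row_sub.
have E c d : (row c (V x) *m dconormal i x *m (row d (V x))^T) 0 0 =
    (V x *m dconormal i x *m V x) c d.
  by rewrite -{2}(Vsym Ox) -row_mul tr_row -[RHS]/(_) [LHS]mxE [RHS]mxE; apply: eq_bigr => j _; rewrite !mxE.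
by rewrite !E => /eqP; rewrite subr_eq0 => /eqP.
Qed.

Lemma continuous_at_sum (x : 'rV[R]_n) (r : seq 'I_n) (F : 'I_n -> 'rV[R]_n -> R) :
  (forall j, {for x, continuous (F j)}) ->
  {for x, continuous (fun y => \sum_(j <- r) F j y)}.
Proof.
move=> cF; elim: r => [|j s IH].
  have -> : (fun y => \sum_(j <- [::]) F j y) = (fun=> 0).
    by apply: funext => y; rewrite big_nil.
  exact: cst_continuous.
have -> : (fun y => \sum_(j <- j :: s) F j y) = (fun y => F j y + \sum_(j <- s) F j y).
  by apply: funext => y; rewrite big_cons.
exact: (continuous_at_add (cF j) IH).
Qed.

(** Only first derivatives of [V] occur. This continuity makes failure of symmetry an open
    condition, which the passage to the support relies on. *)
Lemma dconormal_continuous i a b x : O x ->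
  {for x, continuous (fun y => (V y *m dconormal i y *m V y) a b)}.
Proof.
move=> Ox.
have cV c d : {for x, continuous (fun y => V y c d)}.
  exact: (C1_on_continuous oO (VC1.2 c d) Ox).
have -> : (fun y => (V y *m dconormal i y *m V y) a b) =
    (fun y => \sum_j (\sum_l V y a l * 'D_(e l) (conormal i j) y) * V y j b).
  apply: funext => y; rewrite mxE; apply: eq_bigr => j _; congr (_ * _).
  by rewrite mxE; apply: eq_bigr => l _; rewrite mxE.
apply: continuous_at_sum => j; apply: continuous_at_mul; last exact: cV.
apply: continuous_at_sum => l; apply: continuous_at_mul; first exact: cV.
exact: (C1_on_continuousD oO (conormal_C1 i j) Ox).
Qed.

End Involutivity.

(** * The pairing with forms as a scalar product, and integrability of coefficients *)

Section Pairing.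
Variables (R : realType) (n : nat).
Notation e := (evec R).

Lemma pairing_dotf h (om : Defs.form R n) (tau : 'rV[R]_n -> hvec R n h) x :
  pairing om tau x = dotf [ffun I : {set 'I_n} => om x I] (hext (tau x)).
Proof.
rewrite /dotf (bigID (fun I : {set 'I_n} => #|I| == h)) /= [X in _ + X]big1 ?addr0; last first.
  by move=> I Ih; rewrite hext_out // mulr0.
rewrite [RHS](reindex_omap (val : mindex n h -> {set 'I_n}) insub); last first.
  by move=> I Ih; rewrite insubT.
apply: eq_big => [I|I _]; first by rewrite (valP I) valK eqxx.
by rewrite ffunE hextE.
Qed.

(** [dform] is the sum of the creations [cre l] applied to partial derivatives; adjunction moves
    each one onto the multivector as a contraction. *)
Lemma pairing_dform h (om : Defs.form R n) (tau : 'rV[R]_n -> hvec R n h) x :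
  pairing (dform om) tau x =
  \sum_l dotf [ffun I : {set 'I_n} => 'D_(e l) (fun y => om y I) x] (ann l (hext (tau x))).
Proof.
rewrite pairing_dotf.
under eq_bigr do rewrite dotfC dotf_ann.
rewrite exchange_big; apply: eq_bigr => I _ /=.
rewrite ffunE -mulr_sumr mulrC; congr (_ * _).
rewrite /dform big_mkcond; apply: eq_bigr => l _.
by rewrite ffunE; case: ifP => // lI; rewrite ffunE.
Qed.

Lemma dotf_delta (u : fock R n) (K : {set 'I_n}) :
  dotf u [ffun I : {set 'I_n} => (I == K)%:R] = u K.
Proof.
rewrite /dotf (bigD1 K) //= ffunE eqxx mulr1 big1 ?addr0 // => I IK.
by rewrite ffunE (negbTE IK) mulr0.
Qed.

Lemma integrable_hext h (nu : {measure set (Rn_borel R n) -> \bar R})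
    (tau : 'rV[R]_n -> hvec R n h) (K : {set 'I_n}) :
  (forall I, nu.-integrable setT (fun x => (tau x I)%:E)) ->
  nu.-integrable setT (fun x => (hext (tau x) K)%:E).
Proof.
move=> it; case: (boolP (#|K| == h)) => Kh.
  pose I : mindex n h := Sub K Kh.
  rewrite (_ : (fun x => _) = (fun x => (tau x I)%:E)) //.
  by apply: funext => x; rewrite -(hextE (tau x) I).
rewrite (_ : (fun x => _) = cst 0%E); first exact: integrable0.
by apply: funext => x; rewrite hext_out.
Qed.

Lemma integrable_ann (nu : {measure set (Rn_borel R n) -> \bar R})
    (u : 'rV[R]_n -> fock R n) :
  (forall K, nu.-integrable setT (fun x => (u x K)%:E)) ->
  forall j K, nu.-integrable setT (fun x => (ann j (u x) K)%:E).
Proof.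
move=> iu j K; have [jK|jK] := boolP (j \in K).
  rewrite (_ : (fun x => _) = cst 0%E); first exact: integrable0.
  by apply: funext => x; rewrite ffunE jK.
rewrite (_ : (fun x => _) = (fun x => ((osign R j K)%:E * (u x (j |: K)%SET)%:E)%E)); last first.
  by apply: funext => x; rewrite ffunE (negbTE jK).
exact: (integrableZl measurableT).
Qed.

Lemma integrable_sumr (I : finType) (nu : {measure set (Rn_borel R n) -> \bar R})
    (F : I -> 'rV[R]_n -> R) :
  (forall i, nu.-integrable setT (fun x => (F i x)%:E)) ->
  nu.-integrable setT (fun x => (\sum_i F i x)%:E).
Proof.
move=> iF; rewrite (_ : (fun x => _) = (fun x => (\sum_i (F i x)%:E)%E)).
  by apply: integrable_sum.
by apply: funext => x; rewrite sumEFin.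
Qed.

Lemma integral_sumr (I : finType) (nu : {measure set (Rn_borel R n) -> \bar R})
    (F : I -> 'rV[R]_n -> R) :
  (forall i, nu.-integrable setT (fun x => (F i x)%:E)) ->
  (\int[nu]_x (\sum_i F i x)%:E = \sum_i \int[nu]_x (F i x)%:E)%E.
Proof.
move=> iF; rewrite -(integral_sum measurableT) //.
by apply: eq_integral => x _; rewrite sumEFin.
Qed.

Lemma annvE (a : 'rV[R]_n) (u : fock R n) (K : {set 'I_n}) :
  annv a u K = \sum_j a 0 j * ann j u K.
Proof. by rewrite /annv sum_ffunE; apply: eq_bigr => j _; rewrite [LHS]ffunE. Qed.

End Pairing.

(** * The boundary identity tested against conormal forms, near one point *)

Section Localization.
Variables (R : realType) (n k : nat) (O : set 'rV[R]_n) (V : 'rV[R]_n -> 'M[R]_n).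
Variables (mu mu' : {measure set (Rn_borel R n) -> \bar R}).
Variables (tau : 'rV[R]_n -> hvec R n k) (tau' : 'rV[R]_n -> hvec R n k.-1).
Notation e := (evec R).
Hypotheses (oO : open O) (VC1 : C1_distribution k O V).
Hypothesis NC : normal_current O mu tau mu' tau'.
Hypothesis tan : {ae mu, forall x, spanv (tau x) = rowspace_set (V x)}.

Let it I : mu.-integrable setT (fun x => (tau x I)%:E). Proof. by case: NC => _ _ [+ _] _ _. Qed.
Let it' I : mu'.-integrable setT (fun x => (tau' x I)%:E). Proof. by case: NC => _ _ [_ +] _ _. Qed.
(** Coefficients of contractions: once for the density of the boundary, twice in [T] for that of the
    current. *)
Let T' j (K : {set 'I_n}) (x : 'rV[R]_n) : R := ann j (hext (tau' x)) K.
Let T j l (K : {set 'I_n}) (x : 'rV[R]_n) : R := ann j (ann l (hext (tau x))) K.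
Let iT' j K : mu'.-integrable setT (fun x => (T' j K x)%:E).
Proof. by apply: integrable_ann => J; exact: integrable_hext. Qed.
Let iT j l K : mu.-integrable setT (fun x => (T j l K x)%:E).
Proof. by apply: integrable_ann => J; apply: integrable_ann => J'; exact: integrable_hext. Qed.

Lemma ae_domain (nu : {measure set (Rn_borel R n) -> \bar R}) :
  nu (~` O) = 0%E -> {ae nu, forall x, O x}.
Proof.
move=> nuO; exists (~` O); split => //.
by apply: measurableC; exact: open_measurable_Rn.
Qed.

Let aeO : {ae mu, forall x, O x}. Proof. by apply: ae_domain; case: NC => _ []. Qed.
Let aeO' : {ae mu', forall x, O x}. Proof. by apply: ae_domain; case: NC => _ []. Qed.

Lemma ae_tangent : {ae mu, forall x, tangent_to (V x) (hext (tau x))}.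
Proof.
apply: (@filterS _ _ (ae_filter_ringOfSetsType mu) _ _ _ tan) => x tx.
by apply: spanv_tangent; rewrite tx.
Qed.

Variables (c0 : 'rV[R]_n) (r r' : R).
Hypotheses (r0 : 0 < r) (rr' : r < r') (BO : ball c0 r' `<=` O).
Let QO : cube c0 r `<=` O. Proof. by apply: subset_trans BO; exact: cube_ball. Qed.

(** The test form is [q] times the constant form [dx_j /\ dx_K]. By adjunction, pairing with it
    extracts the coefficient [K] of the contraction by [j], and its differential adds the
    contraction by [l]. *)
Lemma div_identity_test j K (q : 'rV[R]_n -> R) : smooth q ->
  (forall x, ~ cube c0 r x -> q x = 0) ->
  div_identity mu mu' (T' j K) (fun l => T j l K) q.
Proof.
move=> sq q0.
pose w : fock R n := cre j [ffun I : {set 'I_n} => (I == K)%:R].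
pose om : Defs.form R n := fun x I => q x * w I.
have tom : test_form O om.
  split; first by move=> I; exact: (smooth_mul sq (@smooth_cst _ _ (w I))).
  exists (cube c0 r); split => //; first exact: cube_compact.
  by move=> x Qx I; rewrite /om q0 ?mul0r.
have [_ _ _ _ /(_ om tom) E] := NC.
have wu (u : fock R n) (c : R) : dotf [ffun I : {set 'I_n} => c * w I] u = c * ann j u K.
  rewrite -(dotf_delta (ann j u) K) dotf_ann -/w /dotf mulr_sumr.
  by apply: eq_bigr => I _; rewrite ffunE -mulrA [w I * _]mulrC.
rewrite /div_identity.
have <- : (\int[mu']_x (pairing om tau' x)%:E = \int[mu']_x (q x * T' j K x)%:E)%E.
  by apply: eq_integral => x _; rewrite pairing_dotf wu.
rewrite E; apply: eq_integral => x _; rewrite pairing_dform; congr (_%:E).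
apply: eq_bigr => l _.
rewrite -[RHS]wu; congr (dotf _ _); apply/ffunP => I; rewrite [LHS]ffunE [RHS]ffunE.
have [_ ->] := is_derive_mul (smooth_is_derive l x sq) (is_derive_cst (w I) x (e l)).
by rewrite mulr0 add0r mulrC.
Qed.

Variable psi : 'rV[R]_n -> R.
Hypotheses (spsi : smooth psi) (psi0 : forall x, ~ cube c0 r x -> psi x = 0).
Let cB i j : C1_on (ball c0 r') (conormal V i j).
Proof. exact: (C1_on_subset oO (@ball_open _ _ c0 r') BO (conormal_C1 oO VC1 i j)). Qed.

Let idC1 i j K q (sq : smooth q) (q0 : forall x, ~ cube c0 r x -> q x = 0) :=
  div_identity_C1 (iT' j K) (fun l => iT j l K) r0 rr' (@div_identity_test j K) (cB i j) sq q0.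

(** Up to the cutoff [psi], a coefficient of the boundary density contracted with the [i]-th
    conormal form. [curv_contraction] is the analogue for the exterior derivative of that form and
    the density of the current. *)
Definition bdry_contraction i K x := \sum_j (psi x * conormal V i j x) * T' j K x.
Definition curv_contraction i K x :=
  \sum_j \sum_l (psi x * 'D_(e l) (conormal V i j) x) * T j l K x.

Lemma bdry_contraction_integrable i K :
  mu'.-integrable setT (fun x => (bdry_contraction i K x)%:E).
Proof.
apply: integrable_sumr => j; have [sf _] := idC1 i j K spsi psi0.
have := C1_supp_integrable (iT' j K) sf; congr (_.-integrable _ _).
by apply: funext => x; rewrite [psi x * _]mulrC.
Qed.

(** The derivatives of the conormal form are controlled only on [O]. The Leibniz rule rewrites [psi]
    times such a derivative as a difference of globally continuous functions that vanish off the
    cube, hence are bounded. *)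
Lemma curv_contraction_integrable i K :
  mu.-integrable setT (fun x => (curv_contraction i K x)%:E).
Proof.
apply: integrable_sumr => j; apply: integrable_sumr => l.
have [sf _] := idC1 i j K spsi psi0.
have spsi1 : C1_supp c0 r psi by split=> //; exact: (smooth_C1 openT spsi).
have dpsi0 x : ~ cube c0 r x -> 'D_(e l) psi x = 0 by exact: (C1_supp_D0 l spsi1).
have [sg _] := idC1 i j K (smooth_D l spsi) dpsi0.
pose F x := 'D_(e l) (fun x => conormal V i j x * psi x) x + (-1) * (conormal V i j x * 'D_(e l) psi x).
have FE x : psi x * 'D_(e l) (conormal V i j) x = F x.
  rewrite /F; have [Qx|Qx] := pselect (cube c0 r x); last first.
    by rewrite psi0 // dpsi0 // (C1_supp_D0 l sf) // mul0r !mulr0 addr0.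
  have cD : is_derive x (e l) (conormal V i j) ('D_(e l) (conormal V i j) x).
    by apply: derivableP; have [+ _] := conormal_C1 oO VC1 i j l; apply; exact: QO.
  have [_ ->] := is_derive_mul cD (smooth_is_derive l x spsi); ring.
have cF : continuous F.
  have cf := C1_supp_continuousD (l := l) sf; have cg := C1_supp_continuous sg.
  move=> x; have c1 : {for x, continuous (fun _ : 'rV[R]_n => -1 : R)} by exact: cst_continuous.
  exact: (continuous_at_add (cf x) (continuous_at_mul c1 (cg x))).
have F0 x : ~ cube c0 r x -> F x = 0 by move=> Qx; rewrite -FE psi0 // mul0r.
have [M HM] := vanishing_bounded cF F0.
have := integrable_bounded_mul cF HM (iT j l K); congr (_.-integrable _ _).
by apply: funext => x; rewrite FE.
Qed.

(** Apply the identity to [conormal V i j] times the cutoff [psi * phi] and sum over [j]. The terms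
    that differentiate the cutoff contain the contraction of the conormal form with the tangent
    density, which is 0. *)
Lemma contraction_identity i K (phi : 'rV[R]_n -> R) : smooth phi ->
  (forall x, `|phi x| <= 1) ->
  (\int[mu']_x (phi x * bdry_contraction i K x)%:E =
   \int[mu]_x (phi x * curv_contraction i K x)%:E)%E.
Proof.
move=> sphi phi1; pose q x := psi x * phi x.
have sq : smooth q by exact: smooth_mul.
have q0 x : ~ cube c0 r x -> q x = 0 by move=> Qx; rewrite /q psi0 // mul0r.
have sf j : C1_supp c0 r (fun x => conormal V i j x * q x) by have [] := idC1 i j K sq q0.
have E1 : (\int[mu']_x (phi x * bdry_contraction i K x)%:E =
    \int[mu']_x (\sum_j conormal V i j x * q x * T' j K x)%:E)%E.
  apply: eq_integral => x _; congr (_%:E); rewrite mulr_sumr; apply: eq_bigr => j _.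
  by rewrite /q; ring.
have i1 j := C1_supp_integrable (iT' j K) (sf j).
have i2 j := C1_supp_integrableD (fun l => iT j l K) (sf j).
apply: (etrans E1 (etrans (integral_sumr i1) _)).
have E2 : (\sum_j \int[mu']_x (conormal V i j x * q x * T' j K x)%:E =
    \sum_j \int[mu]_x (\sum_l 'D_(e l) (fun x => conormal V i j x * q x) x * T j l K x)%:E)%E.
  by apply: eq_bigr => j _; have [_ ->] := idC1 i j K sq q0.
apply: (etrans E2 (etrans (esym (integral_sumr i2)) _)).
have icurv := integrable_bounded_mul (smooth_continuous sphi) phi1 (curv_contraction_integrable i K).
apply: ae_eq_integral => //.
- exact: (measurable_int mu (integrable_sumr i2)).
- exact: (measurable_int mu icurv).
apply: (@filterS2 _ _ (ae_filter_ringOfSetsType mu) _ _ _ _ aeO ae_tangent) => x Ox tx _.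
congr (_%:E).
(* Contraction with the conormal form anticommutes with [ann l], so it still kills the density after
   that contraction. *)
have tan0 l : \sum_j conormal V i j x * T j l K x = 0.
  have := annv_ann (conormal_row V i x) l (hext (tau x)).
  rewrite (tx _ (conormal_perp VC1 i Ox)) linear0 oppr0 => /ffunP/(_ K).
  rewrite annvE => sum0.
  transitivity (\sum_j conormal_row V i x 0 j * ann j (ann l (hext (tau x))) K).
    by apply: eq_bigr => j _; rewrite mxE.
  by rewrite sum0 ffunE.
transitivity (\sum_j \sum_l ('D_(e l) q x * (conormal V i j x * T j l K x) +
    phi x * (psi x * 'D_(e l) (conormal V i j) x * T j l K x))).
  apply: eq_bigr => j _; apply: eq_bigr => l _.
  have cD : is_derive x (e l) (conormal V i j) ('D_(e l) (conormal V i j) x).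
    by apply: derivableP; have [+ _] := conormal_C1 oO VC1 i j l; exact.
  have [_ ->] := is_derive_mul cD (smooth_is_derive l x sq).
  by rewrite /q; ring.
under eq_bigr do rewrite big_split /=.
rewrite big_split /= exchange_big /= big1 ?add0r; last first.
  by move=> l _; rewrite -mulr_sumr tan0 mulr0.
by rewrite mulr_sumr; apply: eq_bigr => j _; rewrite mulr_sumr.
Qed.

Let integral_phi0 (nu : {measure set (Rn_borel R n) -> \bar R}) (f phi : 'rV[R]_n -> R) :
  smooth phi -> (forall x, `|phi x| <= 1) -> nu.-integrable setT (fun x => (f x)%:E) ->
  {ae nu, forall x, f x = 0} -> (\int[nu]_x (phi x * f x)%:E = 0)%E.
Proof.
move=> sphi phi1 fi f0.
have fphi := integrable_bounded_mul (smooth_continuous sphi) phi1 fi.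
have z0 : (\int[nu]_x (cst 0 x) = 0 :> \bar R)%E by rewrite integral0.
rewrite -[RHS]z0; apply: ae_eq_integral => //.
  exact: (measurable_int nu fphi).
by apply: (@filterS _ _ (ae_filter_ringOfSetsType nu) _ _ _ f0) => x -> _; rewrite mulr0.
Qed.

Let bump_le1 (m : nat) (a b x : 'rV[R]_n) : `|boxbump m%:R a b x : R| <= 1.
Proof. by have /andP[h0 h1] := @boxbump_ge0_le1 R n m%:R a b x; rewrite ger0_norm. Qed.

(** If one side vanishes almost everywhere, the other has zero integral against every box bump,
    hence vanishes almost everywhere for its own measure. *)
Lemma contraction_ae0 i K :
  {ae mu', forall x, bdry_contraction i K x = 0} <->
  {ae mu, forall x, curv_contraction i K x = 0}.
Proof.
have id m a b := contraction_identity i K (@smooth_boxbump R n m%:R a b) (bump_le1 m a b).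
split=> H.
  apply: (ae_eq0_of_boxbump (curv_contraction_integrable i K)) => m a b.
  rewrite -id; apply: integral_phi0 => //; first exact: smooth_boxbump.
  exact: bdry_contraction_integrable.
apply: (ae_eq0_of_boxbump (bdry_contraction_integrable i K)) => m a b.
rewrite id; apply: integral_phi0 => //; first exact: smooth_boxbump.
exact: curv_contraction_integrable.
Qed.

Lemma bdry_contractionE i K x :
  bdry_contraction i K x = psi x * annv (conormal_row V i x) (hext (tau' x)) K.
Proof.
by rewrite annvE mulr_sumr; apply: eq_bigr => j _; rewrite mxE mulrA.
Qed.

Lemma curv_contractionE i K x : curv_contraction i K x =
  psi x * (\sum_l \sum_j dconormal V i x l j *: ann j (ann l (hext (tau x)))) K.
Proof.
rewrite /curv_contraction exchange_big sum_ffunE mulr_sumr; apply: eq_bigr => l _.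
rewrite sum_ffunE mulr_sumr; apply: eq_bigr => j _.
by rewrite [in RHS]ffunE mxE mulrA.
Qed.

End Localization.

Theorem theorem1p7 (R : realType) (n k : nat) (O : set 'rV[R]_n)
  (V : 'rV[R]_n -> 'M[R]_n)
  (mu : {measure set (Rn_borel R n) -> \bar R}) (tau : 'rV[R]_n -> hvec R n k)
  (mu' : {measure set (Rn_borel R n) -> \bar R}) (tau' : 'rV[R]_n -> hvec R n k.-1) :
  open O -> (1 <= k <= n)%N ->
  C1_distribution k O V ->
  normal_current O mu tau mu' tau' ->
  {ae mu, forall x, spanv (tau x) = rowspace_set (V x)} ->
  ({ae mu', forall x, spanv (tau' x) `<=` rowspace_set (V x)} <->
   msupport mu `&` NV O V = set0).
Proof.
move=> oO _ VC1 NC tan.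
have FA (nu : {measure set (Rn_borel R n) -> \bar R}) := ae_filter_ringOfSetsType nu.
have aeO : {ae mu, forall x, O x} by apply: ae_domain => //; case: NC => _ [].
have aeO' : {ae mu', forall x, O x} by apply: ae_domain => //; case: NC => _ [].
have taen0 : {ae mu, forall x, hext (tau x) != 0}.
  case: NC => _ _ _ [t0 _] _; apply: (@filterS _ _ (FA mu) _ _ _ t0) => x [I tI].
  by apply: contra tI => /eqP/ffunP/(_ (val I)); rewrite hextE ffunE => ->.
have aetan := ae_tangent tan.
(* Twice the radius stays in [O]: the cutoff lives on the cube of radius [r], the conormal form on
   the ball of radius [2 r]. *)
have loc x : O x -> exists2 r : R, 0 < r & ball x (r + r) `<=` O.
  move=> Ox; have /nbhs_ballP[d /= d0 dO] : nbhs x O by exact: open_nbhs_nbhs.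
  by exists (d / 2); [rewrite divr_gt0 | rewrite -splitr].
have bump x (r : R) : 0 < r -> exists psi : 'rV[R]_n -> R, [/\ smooth psi,
    forall y, ~ cube x r y -> psi y = 0 & forall y, ball x r y -> 0 < psi y].
  move=> r0; exists (boxbump 1 (x - const_mx r) (x + const_mx r)); split.
  - exact: smooth_boxbump.
  - move=> y cy; apply: boxbump_out => //; rewrite -ball_box // => /(ballP _ _ r0) xy.
    by apply: cy => i; exact: ltW.
  - by move=> y; rewrite ball_box // => xy; exact: boxbump_gt0.
split=> [Hi|Hii].
- have aesym : {ae mu, forall x, O x -> involutive_at O V x}.
    apply: ae_local => x Ox; have [r r0 rO] := loc x Ox.
    have [psi [spsi psi0 psip]] := bump x r r0.
    have rr : r < r + r by rewrite ltrDl.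
    exists r => //.
    (* There are finitely many pairs [(i, K)], so one null set serves them all. *)
    have curv0 : {ae mu, forall y, forall iK : 'I_n * {set 'I_n},
        curv_contraction V tau psi iK.1 iK.2 y = 0}.
      apply: (@filter_forall _ _ _ _ (FA mu)) => -[i K].
      apply: (contraction_ae0 oO VC1 NC tan r0 rr rO spsi psi0 i K).1.
      apply: (@filterS2 _ _ (FA mu') _ _ _ _ aeO' Hi) => y Oy sy.
      rewrite bdry_contractionE (spanv_tangent sy (conormal_perp VC1 i Oy)).
      by rewrite ffunE mulr0.
    have aes := @filterI _ _ (FA mu) _ _ taen0 aetan.
    apply: (@filterS3 _ _ (FA mu) _ _ _ _ _ aeO aes curv0) => y Oy [tn0 ty] cy xy.
    apply/(involutive_conormal oO VC1 Oy) => i.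
    have [Vs Vi Vr] := VC1.1 y Oy.
    apply: (contract_eq0_sym Vs Vi ty tn0) => [K|]; first by rewrite Vr; exact: hext_out.
    apply/ffunP => K; rewrite [RHS]ffunE.
    have /= := cy (i, K); rewrite curv_contractionE => /eqP.
    by rewrite mulf_eq0 gt_eqF /= ?psip // => /eqP.
  rewrite -subset0 => x [suppx [Ox ninv]].
  (* Non-involutivity at [x] is a nonzero antisymmetric entry [G x]. By continuity it persists on a
     ball, which is then null since almost every point is involutive; this contradicts membership in
     the support. *)
  have : exists i a b, (V x *m dconormal V i x *m V x) a b - (V x *m dconormal V i x *m V x) b a != 0.
    apply: contrapT => H; apply: ninv; apply/(involutive_conormal oO VC1 Ox) => i.
    apply/matrixP => a b; rewrite mxE; apply/eqP; rewrite -subr_eq0; apply/negP => /negP ne.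
    by apply: H; exists i, b, a.
  move=> [i [a [b Gx]]].
  pose G y := (V y *m dconormal V i y *m V y) a b + (-1) * (V y *m dconormal V i y *m V y) b a.
  have cG : {for x, continuous G}.
    have c1 : {for x, continuous (fun _ : 'rV[R]_n => -1 : R)} by exact: cst_continuous.
    have cN a' b' : {for x, continuous (fun y => (V y *m dconormal V i y *m V y) a' b')}.
      by apply: (dconormal_continuous oO VC1).
    exact: (continuous_at_add (cN a b) (continuous_at_mul c1 (cN b a))).
  have GN0 : 0 < `|G x| by rewrite normr_gt0 /G mulN1r.
  have /cvgrPdist_lt/(_ _ GN0)/nbhs_ballP[d /= d0 dG] : G y @[y --> x] --> G x by exact: cG.
  have [r r0 rO] := loc x Ox.
  have m0 : 0 < Num.min d r by rewrite lt_min d0 r0.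
  have := suppx _ m0; suff -> : mu (ball x (Num.min d r)) = 0%E by rewrite ltxx.
  apply/(@negligibleP _ _ _ mu); first exact: (open_measurable_Rn (@ball_open _ _ x (Num.min d r))).
  apply: negligibleS aesym => y xy /= H.
  have yd : ball x d y by apply: le_ball xy; rewrite ge_min lexx.
  have Oy : O y.
    apply: rO; apply: le_ball xy; rewrite ge_min; apply/orP; right.
    by rewrite lerDl ltW.
  have /(involutive_conormal oO VC1 Oy)/(_ i) /matrixP/(_ a b) := H Oy.
  rewrite mxE => sy; have Gy : G y = 0 by rewrite /G sy mulN1r subrr.
  by have := dG y yd; rewrite Gy subr0 ltxx.
(* The complement of the support is null, being locally null. *)
- have aesupp : {ae mu, forall x, (~` msupport mu) x -> False}.
    apply: ae_local => x /existsNP[r /not_implyP[r0 /negP]].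
    rewrite -leNgt => mur; exists r => //.
    exists (ball x r); split.
    + exact: (open_measurable_Rn (@ball_open _ _ x r)).
    + by apply/eqP; rewrite eq_le mur measure_ge0.
    + by move=> y /= H; apply: contrapT => xy; apply: H.
  have aeb : {ae mu', forall x, O x -> spanv (tau' x) `<=` rowspace_set (V x)}.
    apply: ae_local => x Ox; have [r r0 rO] := loc x Ox.
    have [psi [spsi psi0 psip]] := bump x r r0.
    have rr : r < r + r by rewrite ltrDl.
    exists r => //.
    have bdry0 : {ae mu', forall y, forall iK : 'I_n * {set 'I_n},
        bdry_contraction V tau' psi iK.1 iK.2 y = 0}.
      apply: (@filter_forall _ _ _ _ (FA mu')) => -[i K].
      apply: (contraction_ae0 oO VC1 NC tan r0 rr rO spsi psi0 i K).2.
      apply: (@filterS3 _ _ (FA mu) _ _ _ _ _ aeO aetan aesupp) => y Oy ty sy.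
      have [Vs Vi Vr] := VC1.1 y Oy.
      (* Almost every [y] lies in the support, which avoids the non-involutive points by (ii). *)
      have inv : involutive_at O V y.
        apply: contrapT => ninv; have : (msupport mu `&` NV O V) y.
          by split; [apply: contrapT => /sy | split].
        by rewrite Hii.
      rewrite curv_contractionE (contract_sym Vs Vi ty); first by rewrite ffunE mulr0.
      exact: ((involutive_conormal oO VC1 Oy).1 inv i).
    apply: (@filterS2 _ _ (FA mu') _ _ _ _ aeO' bdry0) => y Oy by0 xy.
    have [Vs Vi _] := VC1.1 y Oy.
    apply: (tangent_spanv Vs Vi); apply/(tangent_conormal VC1 _ Oy) => i.
    apply/ffunP => K; rewrite [RHS]ffunE.
    have /= := by0 (i, K); rewrite bdry_contractionE => /eqP.
    by rewrite mulf_eq0 gt_eqF /= ?psip // => /eqP.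
  by apply: (@filterS2 _ _ (FA mu') _ _ _ _ aeO' aeb) => x Ox; exact.
Qed.
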